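(* Let $H$ be a simple planar graph with $\Delta(H)\le4$. Then there exists a $4$-regular simple planar graph $G$ containing $H$ as a subgraph if and only if there exists a $4$-regular planar multigraph $G'$ containing $H$ as a subgraph with $V(G')=V(H)$.
   Context: Multigraphs may have multiple edges and loops (a loop contributing $2$ to the degree of its vertex). $\Delta(H)$ is the maximum degree of $H$. *)

(* Defs.v *)
From HB Require Import structures.
From mathcomp Require Import all_boot all_order all_algebra.
From mathcomp Require Import all_classical all_reals all_analysis.

Set Implicit Arguments.
Unset Strict Implicit.
Unset Printing Implicit Defensive.

Import Order.TTheory GRing.Theory Num.Theory.
Import numFieldNormedType.Exports.

Local Open Scope classical_set_scope.
Local Open Scope ring_scope.

(* Finite undirected multigraphs on the vertex type V.  Every edge carries the
   set of its ends: a pair for an ordinary edge, a singleton for a loop;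
   distinct edges may have the same ends. *)
Record multigraph (V : finType) := Multigraph {
  edge : finType;
  ends : edge -> {set V};
  ends_card : forall e, (0 < #|ends e| <= 2)%N
}.

Arguments edge {V} _.
Arguments ends {V} _ _.

Definition simple (V : finType) (G : multigraph V) : Prop :=
  (forall e, #|ends G e| = 2%N) /\ injective (ends G).

(* The second term makes a loop count twice. *)
Definition degree (V : finType) (G : multigraph V) (v : V) : nat :=
  (#|[pred e | v \in ends G e]| + #|[pred e | ends G e == [set v]%SET]|)%N.

Definition max_degree (V : finType) (G : multigraph V) : nat :=
  (\max_(v : V) degree G v)%N.

Definition regular (k : nat) (V : finType) (G : multigraph V) : Prop :=
  forall v, degree G v = k.

(* Inclusion of H into G acting as f on vertices. *)
Definition subgraph_via (V W : finType) (f : V -> W)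
    (H : multigraph V) (G : multigraph W) : Prop :=
  injective f /\
  exists2 g : edge H -> edge G,
    injective g & forall e, ends G (g e) = (f @: ends H e)%SET.

Definition subgraph (V W : finType) (H : multigraph V) (G : multigraph W) :
    Prop :=
  exists f : V -> W, subgraph_via f H G.

Definition spanning_subgraph (V : finType) (H G : multigraph V) : Prop :=
  subgraph_via id H G.

(* A drawing in the plane without crossings.  The edge e is the image of
   [0, 1] under the continuous map arc e.  The last two conditions say that the
   open arcs are injective, pairwise disjoint and free of vertices, so that an
   ordinary edge is a simple arc and a loop a simple closed curve. *)
Record plane_drawing (R : realType) (V : finType) (G : multigraph V)
    (pos : V -> R * R) (arc : edge G -> R -> R * R) : Prop := PlaneDrawing {
  pos_inj : injective pos;
  arc_continuous : forall e, {within `[0, 1], continuous (arc e)};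
  arc_ends : forall e,
    [set arc e 0; arc e 1] = pos @` [set v | v \in ends G e];
  arc_avoids_vertices : forall e (t : R) v, t \in `]0, 1[ -> arc e t <> pos v;
  arc_no_crossing : forall e e' (s t : R),
    s \in `]0, 1[ -> t \in `]0, 1[ ->
    arc e s = arc e' t -> e = e' /\ s = t
}.

Definition planar (R : realType) (V : finType) (G : multigraph V) : Prop :=
  exists (pos : V -> R * R) (arc : edge G -> R -> R * R),
    plane_drawing pos arc.

(* Main.v *)
(* Drawings are handled through the point sets of their open edges.

   From [G] to [G']: the vertices of [G] outside [H] are eliminated one at a
   time.  Loops at such a vertex are dropped, so that 0, 2 or 4 edges remain.
   Two edges are joined through the vertex.  With four edges, cut each of them
   where it first hits a small circle around the vertex and join the four
   points of the circle by two disjoint chords: among the three ways of pairing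
   them, only one is crossing.

   From [G'] to [G]: every edge of [G'] outside [H], loop or not, is cut open
   inside a small disc around one of its points, and an octahedron minus an edge
   is inserted there; its two vertices of degree 3 are joined to the two loose
   ends, so the result has no multiple edges or loops left at this place. *)

Require Import Defs.
From HB Require Import structures.
From mathcomp Require Import all_boot all_order all_algebra.
From mathcomp Require Import all_classical all_reals all_analysis.
From mathcomp Require Import zify ring lra.

Set Implicit Arguments.
Unset Strict Implicit.
Unset Printing Implicit Defensive.

Import Order.TTheory GRing.Theory Num.Theory.
Import numFieldNormedType.Exports.

Local Open Scope classical_set_scope.
Local Open Scope ring_scope.

(** * Arcs in the plane *)

Section PlaneArcs.
Variable R : realType.
Implicit Types (p q r c z : R * R) (A B : set (R * R)) (s t : R).

(** The edges at a vertex have no ready cyclic order: a continuous arc may meet a small circle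
    infinitely often or spiral towards its end. Cutting at the first hit discards this behaviour,
    and the distance to the centre then separates the pieces: the kept tails lie outside the disc,
    everything inserted is straight and lies inside. Crossings inside the disc are controlled by
    signs of signed areas. Neither construction touches [H]: its edges avoid the eliminated
    vertices, and only edges outside it are replaced. Joining edges may create loops and parallel
    edges, which [G'] may have. Conversely, an octahedron minus an edge lacks exactly two degrees,
    one at each of two vertices, and the two halves of a cut edge supply them; all other degrees
    stay 4. *)

Lemma continuous_pair (T : topologicalType) (f g : T -> R) :
  continuous f -> continuous g -> continuous (fun x => (f x, g x)).
Proof.
move=> cf cg x; apply: (@cvg_pair _ _ _ _ (nbhs (f x)) (nbhs (g x)) _ _ _ f g).
  exact: cf.
exact: cg.
Qed.

Lemma continuous_fst (T : topologicalType) (f : T -> R * R) :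
  continuous f -> continuous (fun x => (f x).1).
Proof.
move=> cf x; apply: (@continuous_comp _ _ _ f fst); first exact: cf.
by move=> A hA; exact: (@cvg_fst _ _ (nbhs (f x).1) (nbhs (f x).2)).
Qed.

Lemma continuous_snd (T : topologicalType) (f : T -> R * R) :
  continuous f -> continuous (fun x => (f x).2).
Proof.
move=> cf x; apply: (@continuous_comp _ _ _ f snd); first exact: cf.
by move=> A hA; exact: (@cvg_snd _ _ (nbhs (f x).1) (nbhs (f x).2)).
Qed.

(** Composing with [clamp] turns a map continuous only within [[0, 1]] into one continuous on the
    whole line with the same values on [[0, 1]]. It also lets a path wait at its ends, which
    [open_arc_concat] exploits. *)
Definition clamp t : R := Num.max 0 (Num.min t 1).

Lemma clamp_ge0_le1 t : 0 <= clamp t <= 1.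
Proof. by rewrite /clamp le_max lexx ge_max ler01 ge_min lexx orbT. Qed.

Lemma clamp_id t : 0 <= t <= 1 -> clamp t = t.
Proof. by rewrite /clamp => /andP[t0 t1]; rewrite (min_l t1) (max_r t0). Qed.

Lemma clamp_le0 t : t <= 0 -> clamp t = 0.
Proof. by rewrite /clamp => t0; rewrite min_l ?max_l //; lra. Qed.

Lemma clamp_ge1 t : 1 <= t -> clamp t = 1.
Proof. by rewrite /clamp => t1; rewrite (min_r t1) max_r. Qed.

Lemma continuous_clamp : continuous clamp.
Proof.
move=> t; apply: (@continuous_max R R (cst 0) (fun x => Num.min x 1)).
  exact: cst_continuous.
apply: (@continuous_min R R id (cst 1)); first exact: cvg_id.
exact: cst_continuous.
Qed.

Lemma continuous_clamp_comp (f : R -> R * R) :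
  {within `[0, 1], continuous f} -> continuous (f \o clamp).
Proof.
move=> /subspace_continuousP cf t.
have c01 : `[0, 1]%classic (clamp t) by rewrite /= in_itv /= clamp_ge0_le1.
apply: cvg_comp (cf _ c01) => P PA.
have cP : \forall u \near t, `[0, 1]%classic (clamp u) -> P (clamp u).
  exact: continuous_clamp PA.
suff : \forall u \near t, P (clamp u) by [].
by apply: filterS cP => u; apply; rewrite /= in_itv /= clamp_ge0_le1.
Qed.

(** Only the point set is kept, not the parametrisation. Taking [s] in the open and [t] in the
    closed interval keeps inner points away from the ends but allows [p = q], so loops are
    covered. *)
Definition open_arc A p q : Prop :=
  exists g : R -> R * R, [/\ continuous g, g 0 = p, g 1 = q,
    forall z, A z <-> exists2 t, 0 < t < 1 & g t = z
    & forall s t, 0 < s < 1 -> 0 <= t <= 1 -> g s = g t -> s = t].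

Lemma open_arc_sym A p q : open_arc A p q -> open_arc A q p.
Proof.
move=> [g [cg g0 g1 gA ginj]]; exists (fun t => g (1 - t)); split.
- move=> t; apply: (@continuous_comp _ _ _ (fun t => 1 - t) g); last exact: cg.
  by apply: continuousB; [exact: cst_continuous|exact: cvg_id].
- by rewrite subr0.
- by rewrite subrr.
- move=> z; rewrite gA; split=> -[t t01 <-]; exists (1 - t); rewrite ?subKr //; lra.
- move=> s t s01 t01 gst'; suff : 1 - s = 1 - t by lra.
  by apply: (ginj _ _ _ _ gst'); lra.
Qed.

Lemma open_arc_notin_l A p q : open_arc A p q -> ~ A p.
Proof.
move=> [g [_ g0 _ gA ginj]] /gA[t t01 gt].
suff : t = 0 by lra.
by apply: ginj => //; [lra|rewrite gt].
Qed.

Lemma open_arc_notin_r A p q : open_arc A p q -> ~ A q.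
Proof. by move=> /open_arc_sym/open_arc_notin_l. Qed.

Lemma continuous_affine_reparam (g : R -> R * R) (a b : R) :
  continuous g -> continuous (fun t => g (a + b * t)).
Proof.
move=> cg t; apply: (@continuous_comp _ _ _ (fun t => a + b * t) g); last exact: cg.
apply: continuousD; first exact: cst_continuous.
by apply: continuousM; [exact: cst_continuous|exact: cvg_id].
Qed.

Lemma open_subarc (g : R -> R * R) (a b : R) : continuous g ->
  0 <= a -> a < b -> b <= 1 ->
  (forall s t, 0 < s < 1 -> 0 <= t <= 1 -> g s = g t -> s = t) ->
  open_arc [set z | exists2 t, a < t < b & g t = z] (g a) (g b).
Proof.
move=> cg a0 ab b1 ginj; exists (fun t => g (a + (b - a) * t)).
have ba0 : 0 < b - a by lra.
split; first exact: continuous_affine_reparam.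
- by rewrite mulr0 addr0.
- by rewrite mulr1 addrC subrK.
- move=> z; split=> -[t t01 <-].
    exists ((t - a) / (b - a)); last by congr g; field; lra.
    by rewrite divr_gt0 ?subr_gt0 ?ltr_pdivrMr ?mul1r; lra.
  exists (a + (b - a) * t) => //; nra.
- move=> s t s01 t01 gst; have : a + (b - a) * s = a + (b - a) * t.
    by apply: (ginj _ _ _ _ gst); nra.
  by move=> /addrI/mulfI; apply; rewrite gt_eqF.
Qed.

Lemma open_arc_split A p q : open_arc A p q ->
  exists m A1 A2, [/\ open_arc A1 p m, open_arc A2 m q, A m,
    A1 `<=` A /\ A2 `<=` A & forall z, A1 z -> ~ A2 z].
Proof.
move=> [g [cg g0 g1 gA ginj]].
have h1 := @open_subarc g 0 2^-1 cg _ _ _ ginj.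
have h2 := @open_subarc g 2^-1 1 cg _ _ _ ginj.
exists (g 2^-1); eexists; eexists; split; rewrite -?g0 -?g1; [apply: h1; lra|apply: h2; lra|..].
- by apply/gA; exists 2^-1 => //; lra.
- split; first by move=> z /= [t t01 <-]; apply/gA; exists t => //; lra.
  by move=> z /= [t t01 <-]; apply/gA; exists t => //; lra.
- move=> z /= [t t01 <-] [s s01 gst']; suff : s = t by lra.
  by apply: (ginj _ _ _ _ gst'); lra.
Qed.

(* As [g2] is constant until time 1/2 and [g1] after it, their sum minus [q]
   runs through the first arc and then through the second. *)
Lemma open_arc_concat A B p q r : open_arc A p q -> open_arc B q r ->
  p <> q -> q <> r -> ~ B p -> ~ A r -> (forall z, A z -> ~ B z) ->
  open_arc [set z | [\/ A z, z = q | B z]] p r.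
Proof.
move=> Aarc Barc pq qr Bp Ar AB.
have Aq := open_arc_notin_r Aarc; have Bq := open_arc_notin_l Barc.
case: Aarc => g1 [cg1 g10 g11 g1A g1inj].
case: Barc => g2 [cg2 g20 g21 g2B g2inj].
pose g t : R * R :=
  ((g1 (clamp (2 * t))).1 + ((g2 (clamp (2 * t - 1))).1 - q.1),
   (g1 (clamp (2 * t))).2 + ((g2 (clamp (2 * t - 1))).2 - q.2)).
have gl t : 0 <= t <= 2^-1 -> g t = g1 (2 * t).
  move=> t01; rewrite /g (@clamp_le0 (2 * t - 1)); last lra.
  rewrite clamp_id; last lra.
  by rewrite g20 !subrr !addr0; case: (g1 _).
have gr t : 2^-1 <= t <= 1 -> g t = g2 (2 * t - 1).
  move=> t01; rewrite /g (@clamp_ge1 (2 * t)); last lra.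
  rewrite clamp_id; last lra.
  by rewrite g11 !(addrC q.1) !(addrC q.2) !subrK; case: (g2 _).
have cl1 : continuous (fun t => g1 (clamp (2 * t))).
  move=> t; apply: (@continuous_comp _ _ _ (fun t => clamp (2 * t)) g1); last exact: cg1.
  apply: (@continuous_comp _ _ _ (fun t => 2 * t) clamp); last exact: continuous_clamp.
  by apply: continuousM; [exact: cst_continuous|exact: cvg_id].
have cl2 : continuous (fun t => g2 (clamp (2 * t - 1))).
  move=> t; apply: (@continuous_comp _ _ _ (fun t => clamp (2 * t - 1)) g2); last exact: cg2.
  apply: (@continuous_comp _ _ _ (fun t => 2 * t - 1) clamp); last exact: continuous_clamp.
  apply: continuousB; last exact: cst_continuous.
  by apply: continuousM; [exact: cst_continuous|exact: cvg_id].
exists g; split.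
- apply: continuous_pair; move=> t; (apply: cvgD; [|apply: cvgB; [|exact: cvg_cst]]).
  + exact: (continuous_fst cl1).
  + exact: (continuous_fst cl2).
  + exact: (continuous_snd cl1).
  + exact: (continuous_snd cl2).
- by rewrite -g10 gl; [congr g1; lra|lra].
- by rewrite -g21 gr; [congr g2; lra|lra].
- move=> z; split.
  + case=> [/g1A[t t01 <-]|->|/g2B[t t01 <-]].
    * exists (t / 2); first lra.
      by rewrite gl; [congr g1; field|lra].
    * exists 2^-1; first lra.
      by rewrite -g11 gl; [congr g1; lra|lra].
    * exists ((t + 1) / 2); first lra.
      by rewrite gr; [congr g2; field|lra].
  + move=> [t t01 <-]; case: (ltrgtP t 2^-1) => th.
    * by rewrite gl; [apply: Or31; apply/g1A; exists (2 * t) => //; lra|lra].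
    * by rewrite gr; [apply: Or33; apply/g2B; exists (2 * t - 1) => //; lra|lra].
    * by apply: Or32; rewrite th -g11 gl; [congr g1; lra|lra].
- move=> s t s01 t01 gst.
  (* Times on opposite sides of the midpoint can give the same point only at 0 and 1, when [p = r];
     the last condition excludes this pair. *)
  have ABc : forall u v, 0 <= u -> u < 2^-1 -> 2^-1 < v -> v <= 1 -> 0 < u \/ v < 1 -> g u <> g v.
    move=> u v u0 u1 v0 v1 uv; rewrite gl; last lra; rewrite gr; last lra.
    have [u00|u00] := ltP 0 u.
      have Au : A (g1 (2 * u)) by apply/g1A; exists (2 * u) => //; lra.
      have [v11|v11] := ltP v 1.
        by move=> uE; apply: (AB _ Au); rewrite uE; apply/g2B; exists (2 * v - 1) => //; lra.
      have -> : 2 * v - 1 = 1 by lra.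
      by rewrite g21 => uE; rewrite uE in Au.
    have -> : 2 * u = 0 by lra.
    rewrite g10 => pE; apply: Bp; rewrite pE; apply/g2B; exists (2 * v - 1) => //; lra.
  have [s1|s1] := leP s 2^-1; have [t1|t1] := leP t 2^-1.
  + move: gst; rewrite gl; last lra; rewrite gl; last lra.
    have [s2|s2] := ltP s 2^-1 => gst.
      suff : 2 * s = 2 * t by lra.
      by apply: (g1inj _ _ _ _ gst); lra.
    have [t2|t2] := ltP t 2^-1; last lra.
    have [t0|t0] := ltP 0 t.
      suff : 2 * t = 2 * s by lra.
      by apply: (g1inj _ _ _ _ (esym gst)); lra.
    move: gst; have -> : 2 * t = 0 by lra.
    have -> : 2 * s = 1 by lra.
    by rewrite g10 g11 => /esym.
  + have [s2|s2] := ltP s 2^-1; first by case: (@ABc s t) => //; lra.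
    have s12 : s = 2^-1 by lra.
    have [t2|t2] := ltP t 1; last first.
      move: gst; rewrite gl; last lra; rewrite gr; last lra.
      have -> : 2 * s = 1 by lra.
      have -> : 2 * t - 1 = 1 by lra.
      by rewrite g11 g21.
    move: gst; rewrite gr; last lra; rewrite gr; last lra.
    move=> gst; suff : 2 * t - 1 = 2 * s - 1 by lra.
    by apply: (g2inj _ _ _ _ (esym gst)); lra.
  + have [t2|t2] := ltP t 2^-1.
      by case: (@ABc t s) => //; lra.
    move: gst; rewrite gr; last lra; rewrite gr; last lra.
    move=> gst; suff : 2 * s - 1 = 2 * t - 1 by lra.
    by apply: (g2inj _ _ _ _ gst); lra.
  + move: gst; rewrite gr; last lra; rewrite gr; last lra.
    move=> gst; suff : 2 * s - 1 = 2 * t - 1 by lra.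
    by apply: (g2inj _ _ _ _ gst); lra.
Qed.
End PlaneArcs.

(** * Discs, segments and chords *)

Section PlaneGeometry.
Variable R : realType.
Implicit Types (a b c d p q x z : R * R) (A B : set (R * R)) (s t r : R).

(** Squares keep all distance estimates polynomial; every radius [r] below is accordingly a squared
    radius. *)
Definition dist2 z c : R := (z.1 - c.1) ^+ 2 + (z.2 - c.2) ^+ 2.

Lemma dist2_center c : dist2 c c = 0.
Proof. by rewrite /dist2 !subrr expr0n addr0. Qed.

Lemma continuous_dist2 (g : R -> R * R) c :
  continuous g -> continuous (fun t => dist2 (g t) c).
Proof.
move=> cg t; have c1 := continuous_fst cg; have c2 := continuous_snd cg.
by apply: cvgD; rewrite -?expr2; apply: cvgM; apply: cvgB;
  try (exact: c1 || exact: c2); exact: cvg_cst.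
Qed.

(** The times in [[0, 1]] spent in the closed disc form a nonempty compact set. Its minimum is the
    first hit, and by the intermediate value theorem the squared distance there equals [r]. *)
Lemma first_hit A p q c r : open_arc A p q -> r < dist2 p c -> dist2 q c < r ->
  exists A' x, [/\ open_arc A' p x, A' `<=` A, A x, dist2 x c = r
    & forall z, A' z -> r < dist2 z c].
Proof.
move=> [g [cg g0 g1 gA ginj]] pr qr.
pose F t := dist2 (g t) c.
have cF : continuous F by exact: continuous_dist2.
pose E : set R := `[0, 1]%classic `&` [set t | F t <= r].
have E0 : E !=set0.
  by exists 1; split; [rewrite /= in_itv /=; lra|rewrite /E /F /= g1 ltW].
have cE : compact E.
  apply: compact_closedI; first exact: segment_compact.
  exact: (closed_comp (fun t _ => cF t) (@closed_le R r)).
have cid : {within E, continuous (@idfun R)}.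
  by apply: continuous_subspaceT => t; exact: cvg_id.
have [t0] := compact_EVT_min E0 cE cid.
rewrite inE => -[t001 /= Ft0] t0min; move: t001; rewrite /= in_itv /= => t001.
have t00 : 0 < t0.
  rewrite lt_neqAle eq_sym; apply/andP; split; last lra.
  by apply: contraTneq Ft0 => ->; rewrite -ltNge /F g0.
have tr t : 0 <= t < t0 -> r < F t.
  move=> ht; rewrite ltNge; apply/negP => Ftr.
  have : t0 <= t; last lra.
  by apply: t0min; rewrite inE; split => //=; rewrite in_itv /=; lra.
have Fr : F t0 = r.
  have [] := @IVT R F 0 t0 r (ltW t00) (continuous_subspaceT cF).
    rewrite ge_min le_max Ft0 orbT /=.
    by rewrite /F g0 (ltW pr).
  move=> u; rewrite in_itv /= => /andP[u0 ut] Fu.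
  have [|tu] := ltP u t0; last by have -> : t0 = u by lra.
  by move=> ut0; have := tr u; rewrite Fu ltxx u0 ut0 => /(_ isT).
have t01 : t0 < 1.
  rewrite lt_neqAle; apply/andP; split; last lra.
  by apply: contraTneq qr => t0E; rewrite -Fr t0E /F g1 ltxx.
have sub := @open_subarc R g 0 t0 cg _ _ _ ginj.
eexists; exists (g t0); split; [rewrite -g0; apply: sub; lra|..] => //=.
- by move=> z /= [t ht <-]; apply/gA; exists t => //; lra.
- by apply/gA; exists t0 => //; lra.
- by move=> z /= [t ht <-]; apply: tr; lra.
Qed.

Definition lerp p q t : R * R := (p.1 + t * (q.1 - p.1), p.2 + t * (q.2 - p.2)).

Lemma lerp0 p q : lerp p q 0 = p.
Proof. by rewrite /lerp !mul0r !addr0; case: p. Qed.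

Lemma lerp1 p q : lerp p q 1 = q.
Proof. by rewrite /lerp !mul1r !(addrC p.1) !(addrC p.2) !subrK; case: q. Qed.

Definition open_segment p q : set (R * R) :=
  [set z | exists2 t, 0 < t < 1 & lerp p q t = z].

Lemma pair_neq p q : p <> q -> p.1 != q.1 \/ p.2 != q.2.
Proof.
move=> pq; have [e1|] := eqVneq p.1 q.1; last by left.
have [e2|] := eqVneq p.2 q.2; last by right.
by case: pq; rewrite (surjective_pairing p) e1 e2 -surjective_pairing.
Qed.

Lemma open_arc_segment p q : p <> q -> open_arc (open_segment p q) p q.
Proof.
move=> pq; exists (lerp p q); split.
- apply: continuous_pair; move=> t; apply: cvgD; (try exact: cvg_cst);
  (apply: cvgM; [exact: cvg_id|exact: cvg_cst]).
- exact: lerp0.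
- exact: lerp1.
- by [].
- move=> s t _ _ [/addrI e1 /addrI e2].
  by case: (pair_neq pq) => n; [apply: mulIf e1|apply: mulIf e2];
     rewrite subr_eq0 eq_sym.
Qed.

(** Stewart's identity; the subtracted term expresses the strict convexity of discs. *)
Lemma dist2_lerp p q c t :
  dist2 (lerp p q t) c = (1 - t) * dist2 p c + t * dist2 q c - t * (1 - t) * dist2 p q.
Proof. by rewrite /dist2 /lerp /=; ring. Qed.

Lemma dist2_ge0 p q : 0 <= dist2 p q.
Proof. by rewrite addr_ge0 ?sqr_ge0. Qed.

Lemma dist2_gt0 p q : p <> q -> 0 < dist2 p q.
Proof.
move=> /pair_neq pq; rewrite /dist2.
by case: pq => n; [apply: ltr_pwDl|apply: ltr_wpDl];
  rewrite ?sqr_ge0 // lt_neqAle sqr_ge0 eq_sym sqrf_eq0 subr_eq0 n.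
Qed.

Lemma open_segment_disc p q c r z : p <> q -> dist2 p c <= r -> dist2 q c <= r ->
  open_segment p q z -> dist2 z c < r.
Proof.
move=> /dist2_gt0 pq pr qr [t t01 <-]; rewrite dist2_lerp.
have : 0 < t * (1 - t) * dist2 p q by rewrite mulr_gt0 // mulr_gt0; lra.
nra.
Qed.

(** Twice the signed area of the triangle [a b c]; its sign tells on which side of the line [a b]
    the point [c] lies. *)
Definition orient a b c : R :=
  (b.1 - a.1) * (c.2 - a.2) - (b.2 - a.2) * (c.1 - a.1).

Lemma orient_lerp_line a b t : orient a b (lerp a b t) = 0.
Proof. by rewrite /orient /lerp /=; ring. Qed.

Lemma orient_lerp a b c d t :
  orient a b (lerp c d t) = (1 - t) * orient a b c + t * orient a b d.
Proof. by rewrite /orient /lerp /=; ring. Qed.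

(** Along [c d] the function [orient a b] is affine. With end values of weakly equal sign and not
    both zero it cannot vanish strictly in between, whereas it vanishes on the line [a b]. One end
    on that line is allowed, so segments sharing an end are covered. *)
Lemma open_segment_disjoint a b c d z :
  0 <= orient a b c * orient a b d ->
  orient a b c != 0 \/ orient a b d != 0 ->
  open_segment a b z -> ~ open_segment c d z.
Proof.
move=> cd n [t t01 <-] [s s01 e].
have := orient_lerp_line a b t; rewrite -e orient_lerp.
move: (orient a b c) (orient a b d) cd n => u v uv n e0.
have [u0|u0|u0] := ltrgtP u 0; have [v0|v0|v0] := ltrgtP v 0; nra.
Qed.

Lemma closed_segment_disjoint a b c d s t : 0 < orient a b c * orient a b d ->
  0 <= s <= 1 -> lerp a b t <> lerp c d s.
Proof.
move=> cd s01 e.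
have := orient_lerp_line a b t; rewrite e orient_lerp.
move: (orient a b c) (orient a b d) cd => u v uv e0.
have [u0|u0|u0] := ltrgtP u 0; have [v0|v0|v0] := ltrgtP v 0; nra.
Qed.

(** If the area vanished, [c] would be some [lerp a b k], and on a circle through [a] and [b]
    Stewart's identity leaves only [k = 0] and [k = 1]. *)
Lemma orient_circle a b c x r : dist2 a x = r -> dist2 b x = r -> dist2 c x = r ->
  a <> b -> a <> c -> b <> c -> orient a b c != 0.
Proof.
move=> ar br cr ab ac bc; apply/eqP => o0.
have d0 := dist2_gt0 ab.
(* Parameter of the orthogonal projection of [c] on the line [a b]. *)
pose k := ((c.1 - a.1) * (b.1 - a.1) + (c.2 - a.2) * (b.2 - a.2)) / dist2 a b.
have cE : lerp a b k = c.
  rewrite [RHS]surjective_pairing; congr (_, _).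
  - have -> : c.1 = a.1 +
        (((c.1 - a.1) * (b.1 - a.1) + (c.2 - a.2) * (b.2 - a.2)) * (b.1 - a.1)
         - (b.2 - a.2) * orient a b c) / dist2 a b.
      by rewrite /orient; move: d0; rewrite /dist2 => d0; field; lra.
    by rewrite o0 /k; field; lra.
  - have -> : c.2 = a.2 +
        (((c.1 - a.1) * (b.1 - a.1) + (c.2 - a.2) * (b.2 - a.2)) * (b.2 - a.2)
         + (b.1 - a.1) * orient a b c) / dist2 a b.
      by rewrite /orient; move: d0; rewrite /dist2 => d0; field; lra.
    by rewrite o0 /k; field; lra.
have : k * (1 - k) * dist2 a b = 0.
  by move: cr; rewrite -cE dist2_lerp ar br => cr; lra.
move=> /eqP; rewrite mulf_eq0 (gt_eqF d0) orbF mulf_eq0 subr_eq0 => /orP[/eqP k0|/eqP k1].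
  by apply: ac; rewrite -cE k0 lerp0.
by apply: bc; rewrite -cE -k1 lerp1.
Qed.

(* The four signed areas satisfy [abc - abd + acd - bcd = 0], which excludes
   that both pairings cross. *)
Lemma circle_pairing a b c d x r :
  dist2 a x = r -> dist2 b x = r -> dist2 c x = r -> dist2 d x = r ->
  a <> b -> a <> c -> a <> d -> b <> c -> b <> d -> c <> d ->
  (0 < orient a b c * orient a b d \/ 0 < orient c d a * orient c d b) \/
  (0 < orient a c b * orient a c d \/ 0 < orient b d a * orient b d c).
Proof.
move=> ar br cr dr ab ac ad bc bd cd.
have n1 := orient_circle ar br cr ab ac bc.
have n2 := orient_circle ar br dr ab ad bd.
have n3 := orient_circle ar cr dr ac ad cd.
have n4 := orient_circle br cr dr bc bd cd.
have -> : orient c d a = orient a c d by rewrite /orient; ring.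
have -> : orient c d b = orient b c d by rewrite /orient; ring.
have -> : orient a c b = - orient a b c by rewrite /orient; ring.
have -> : orient b d a = orient a b d by rewrite /orient; ring.
have -> : orient b d c = - orient b c d by rewrite /orient; ring.
have : orient a b c - orient a b d + orient a c d - orient b c d = 0.
  by rewrite /orient; ring.
move: n1 n2 n3 n4; move: (orient a b c) (orient a b d) (orient a c d) (orient b c d).
move=> u v w y; rewrite !neq_lt.
by case/orP=> u0; case/orP=> v0; case/orP=> w0; case/orP=> y0 e; (lra ||
  ((left; left; nra) || (left; right; nra) || (right; left; nra) || (right; right; nra))).
Qed.

Lemma near_disc c (P : R * R -> Prop) : (\forall z \near c, P z) ->
  exists2 r, 0 < r & forall z, dist2 z c <= r -> P z.
Proof.
(* Balls of the product are squares: squared distance at most [e ^+ 2 / 4] keeps both coordinate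
   differences within [e / 2]. *)
move=> /nbhs_ballP[e /= e0 eP]; exists (e ^+ 2 / 4).
  by rewrite divr_gt0 ?exprn_gt0.
move=> z zr; apply: eP.
have h1 := sqr_ge0 (z.1 - c.1); have h2 := sqr_ge0 (z.2 - c.2).
by split; rewrite /ball /= ltr_norml; move: zr; rewrite /dist2 => zr; nra.
Qed.

(** The arc together with its ends is compact, hence closed, and it misses [c]. *)
Lemma near_open_arcC A p q c : open_arc A p q -> ~ A c -> c <> p -> c <> q ->
  \forall z \near c, ~ A z.
Proof.
move=> [g [cg g0 g1 gA ginj]] Ac cp cq.
have cpt : compact (g @` `[0, 1]).
  apply: continuous_compact; first exact: continuous_subspaceT.
  exact: segment_compact.
have cl : closed (g @` `[0, 1]) := compact_closed (@norm_hausdorff _ _) cpt.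
have : nbhs c (~` (g @` `[0, 1])).
  apply: open_nbhs_nbhs; split; first exact: closed_openC.
  move=> [t]; rewrite /= in_itv /= => t01 gt.
  have [t0|t0] := ltP 0 t; last by apply: cp; rewrite -g0 -gt; congr g; lra.
  have [t1|t1] := ltP t 1; last by apply: cq; rewrite -g1 -gt; congr g; lra.
  by apply: Ac; apply/gA; exists t => //; lra.
apply: filterS => z nz /gA[t t01 gt]; apply: nz; exists t => //=.
by rewrite in_itv /=; lra.
Qed.

Lemma near_neq c x : c <> x -> \forall z \near c, z <> x.
Proof.
move=> cx; have : nbhs c (~` [set x]).
  apply: open_nbhs_nbhs; split => //; apply: closed_openC.
  exact: (accessible_closed_set1 (hausdorff_accessible (@norm_hausdorff _ _))).
exact: filterS.
Qed.

End PlaneGeometry.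

(** * Drawings as families of point sets *)

Section Multigraphs.

(** Contribution of one edge with end set [A] to the degree of [v], so that degrees become sums over
    edges and can be compared edge by edge. *)
Definition incidence (V : finType) (A : {set V}) (v : V) : nat :=
  ((v \in A) + (A == [set v]%SET))%N.

Lemma degree_sum (V : finType) (G : multigraph V) (v : V) :
  degree G v = (\sum_e incidence (ends G e) v)%N.
Proof.
rewrite /degree big_split /= -!sum1_card !big_mkcond /=.
by congr addn; rewrite big_mkcond; apply: eq_bigr => e _; rewrite inE; case: ifP.
Qed.

Lemma incidence2 (V : finType) (x y v : V) :
  incidence [set x; y]%SET v = ((v == x) + (v == y))%N.
Proof.
rewrite /incidence; have [<-|xy] := eqVneq x y.
  by rewrite finset.setUid inE (inj_eq finset.set1_inj) (eq_sym x).
have -> : ([set x; y]%SET == [set v]%SET) = false.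
  by apply/eqP => /(congr1 (fun A : {set V} => #|A|)); rewrite cards2 xy cards1.
rewrite !inE addn0; have [->|] := eqVneq v x; first by rewrite (negbTE xy).
by case: eqVneq.
Qed.

Lemma ends_pair (V : finType) (G : multigraph V) (e : edge G) :
  exists u v, ends G e = [set u; v]%SET.
Proof.
have := ends_card e; case: (pickP (mem (ends G e))) => [u /= ue|e0]; last first.
  by rewrite (eq_card0 e0).
rewrite (cardsD1 u) ue add1n ltnS /= => le1.
case: (pickP (mem (ends G e :\ u))) => [v /= ve|e0]; last first.
  exists u, u; rewrite finset.setUid; apply/setP => z; rewrite inE.
  have := e0 z; rewrite /= !inE; case: eqP => //= -> _; exact: ue.
exists u, v; rewrite -(finset.setD1K ue); congr (_ |: _)%SET.
by apply/eqP; rewrite eq_sym eqEcard finset.sub1set ve cards1.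
Qed.

Variable R : realType.

(** During the elimination the vertex type stays fixed and only [S] shrinks: vertices outside [S]
    carry no edge and put no constraint on [pos]. *)
Definition drawing_on (V : finType) (S : {set V}) (G : multigraph V)
    (pos : V -> R * R) (A : edge G -> set (R * R)) : Prop :=
  [/\ {in S &, injective pos},
    forall e, exists u v, [/\ u \in S, v \in S, ends G e = [set u; v]%SET
      & open_arc (A e) (pos u) (pos v)],
    forall e v, v \in S -> ~ A e (pos v)
  & forall e e' z, A e z -> A e' z -> e = e'].

(** Forward, arcs are extended by [clamp]; backward, one parametrisation per edge is picked by
    choice. *)
Lemma planar_drawing_on (V : finType) (G : multigraph V) :
  planar R G <-> exists pos (A : edge G -> set (R * R)), drawing_on [set: V]%SET pos A.
Proof.
split=> [[pos [arc [pinj carc aends avert across]]]|[pos [A [pinj Aends Avert Across]]]].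
  exists pos, (fun e => arc e @` `]0, 1[); split.
  - by move=> u v _ _; exact: pinj.
  - move=> e.
    have [u ue u0] : (pos @` [set v | v \in ends G e]) (arc e 0) by rewrite -aends; left.
    have [v ve v1] : (pos @` [set v | v \in ends G e]) (arc e 1) by rewrite -aends; right.
    exists u, v; split; rewrite ?inE //.
      apply/setP => x; rewrite !inE; apply/idP/orP => [xe|[]/eqP->//].
      have : [set arc e 0; arc e 1] (pos x) by rewrite aends; exists x.
      by case=> xE; [left|right]; apply/eqP/pinj; rewrite ?u0 ?v1.
    rewrite u0 v1; exists (arc e \o @clamp R); split.
    + exact: continuous_clamp_comp.
    + by rewrite /= clamp_le0.
    + by rewrite /= clamp_ge1.
    + move=> z; split=> -[t /= t01 <-].
        by move: t01; rewrite in_itv /= => t01; exists t => //; rewrite clamp_id //; lra.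
      by exists t; rewrite /= ?in_itv //= clamp_id //; lra.
    + move=> s t s01 t01; rewrite /= !clamp_id //; last lra.
      have [t0|t0] := ltP 0 t; last first.
        have -> : t = 0 by lra.
        by rewrite -u0 => /avert[]; rewrite in_itv.
      have [t1|t1] := ltP t 1; last first.
        have -> : t = 1 by lra.
        by rewrite -v1 => /avert[]; rewrite in_itv.
      by move=> /across[]; rewrite ?in_itv //= ?t0.
  - by move=> e v _ [t /=]; exact: avert.
  - by move=> e e' z [s /= s01 <-] [t /= t01] /esym /across[].
have arcs e : exists g : R -> R * R, [/\ continuous g,
    [set g 0; g 1] = pos @` [set v | v \in ends G e],
    forall t, t \in `]0, 1[ -> A e (g t)
    & forall s t, 0 < s < 1 -> 0 <= t <= 1 -> g s = g t -> s = t].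
  have [u [v [_ _ uv [g [cg g0 g1 gA ginj]]]]] := Aends e; exists g; split=> //.
    rewrite uv g0 g1; apply/seteqP; split=> [z []->|z [x /= ]].
    + by exists u => //=; rewrite !inE eqxx.
    + by exists v => //=; rewrite !inE eqxx orbT.
    + by rewrite !inE => /orP[]/eqP-> <-; [left|right].
  by move=> t; rewrite in_itv /= => t01; apply/gA; exists t.
have [arc arcP] := choice arcs; exists pos, arc; split.
- by move=> u v; apply: pinj; rewrite inE.
- by move=> e; apply: continuous_subspaceT; case: (arcP e).
- by move=> e; case: (arcP e).
- move=> e t v t01 E; have [_ _ /(_ t t01) At _] := arcP e.
  by apply: (Avert e v); rewrite ?inE // -E.
- move=> e e' s t s01 t01 E.
  have [_ _ /(_ s s01) As sinj] := arcP e.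
  have [_ _ /(_ t t01) At _] := arcP e'.
  have ee : e = e' by apply: (Across _ _ _ As); rewrite E.
  split=> //; apply: sinj; [by move: s01; rewrite in_itv| |by rewrite E ee].
  by move: t01; rewrite in_itv /=; lra.
Qed.

(** The drawing fixes some order of the two ends of an edge; reversing the arc makes the other order
    available. *)
Lemma drawing_arc (V : finType) (S : {set V}) (G : multigraph V)
    (pos : V -> R * R) (A : edge G -> set (R * R)) (e : edge G) (u v : V) :
  drawing_on S pos A -> ends G e = [set u; v]%SET ->
  [/\ u \in S, v \in S & open_arc (A e) (pos u) (pos v)].
Proof.
move=> [_ /(_ e) [u' [v' [u'S v'S uv' arc]]] _ _] uv.
have := uv; rewrite uv' => /setP E.
have := E u; have := E v; have := E u'; have := E v'.
rewrite !inE !eqxx ?orbT /= => /esym v'E /esym u'E vE uE.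
have [uu|nuu] := eqVneq u u'; last first.
  have uv2 : u = v' by apply/eqP; move: uE; rewrite (negbTE nuu).
  have vu2 : v = u' by apply/eqP; move: u'E; rewrite eq_sym (negbTE nuu) eq_sym.
  by rewrite uv2 vu2; split=> //; exact: open_arc_sym.
have vv : v = v'.
  apply/eqP; move: vE v'E; rewrite -uu.
  by case: (eqVneq v u) => [->|//]; rewrite orbb eq_sym.
by rewrite uu vv.
Qed.

End Multigraphs.

(** * Bypassing a vertex *)

Section Chords.
Variable R : realType.
Implicit Types (p q c x z : R * R) (A B : set (R * R)) (r t : R).

(** The chord is closed because it supplies the points [x] and [y], which the open pieces lack. *)
Definition through A x y B : set (R * R) :=
  [set z | [\/ A z, exists2 t, 0 <= t <= 1 & lerp x y t = z | B z]].

(* [A'] is the part of the arc [A] from [p] up to the point [x] where it first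
   hits the circle of centre [c] and squared radius [r]. *)
Definition stops_at c r A p A' x : Prop :=
  [/\ r < dist2 p c, open_arc A' p x /\ A' `<=` A, A x, dist2 x c = r
    & forall z, A' z -> r < dist2 z c].

Lemma closed_segment_disc c r x y t : 0 <= t <= 1 -> dist2 x c = r -> dist2 y c = r ->
  dist2 (lerp x y t) c <= r.
Proof.
move=> t01 xr yr; rewrite dist2_lerp xr yr.
have := dist2_ge0 x y; have : 0 <= t * (1 - t) by apply: mulr_ge0; lra.
by move=> h1 h2; have := mulr_ge0 h1 h2; lra.
Qed.

(** This is how a new edge avoids other vertices and edges: its points lie on an old edge or in a
    disc kept clear of them. *)
Lemma through_sub c r A1 p1 A1' x1 A2 p2 A2' x2 z :
  stops_at c r A1 p1 A1' x1 -> stops_at c r A2 p2 A2' x2 ->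
  through A1' x1 x2 A2' z -> [\/ A1 z, dist2 z c <= r | A2 z].
Proof.
move=> [_ [_ s1] _ x1r _] [_ [_ s2] _ x2r _] [/s1|[t t01 <-]|/s2].
- by constructor 1.
- by constructor 2; exact: closed_segment_disc.
- by constructor 3.
Qed.

(** Two concatenations, whose pieces are disjoint because the tails lie strictly outside the circle
    and the open chord strictly inside. The ends [p1] and [p2] may coincide. *)
Lemma open_arc_through c r A1 p1 A1' x1 A2 p2 A2' x2 :
  stops_at c r A1 p1 A1' x1 -> stops_at c r A2 p2 A2' x2 ->
  (forall z, A1 z -> ~ A2 z) -> ~ A1 p2 -> ~ A2 p1 ->
  open_arc (through A1' x1 x2 A2') p1 p2.
Proof.
move=> [p1r [arc1 s1] A1x x1r out1] [p2r [arc2 s2] A2x x2r out2] A12 A1p2 A2p1.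
have x12 : x1 <> x2 by move=> e; apply: (A12 _ A1x); rewrite e.
have seg_in z : open_segment x1 x2 z -> dist2 z c < r.
  by apply: open_segment_disc; rewrite ?x1r ?x2r.
have h1 : open_arc [set z | [\/ A1' z, z = x1 | open_segment x1 x2 z]] p1 x2.
  apply: open_arc_concat arc1 (open_arc_segment x12) _ x12 _ _ _.
  - by move=> e; rewrite e x1r ltxx in p1r.
  - by move=> /seg_in; lra.
  - by move=> /out1; rewrite x2r ltxx.
  - by move=> z /out1 ? /seg_in; lra.
have h2 : open_arc [set z | [\/ [set z | [\/ A1' z, z = x1 | open_segment x1 x2 z]] z,
    z = x2 | A2' z]] p1 p2.
  apply: open_arc_concat h1 (open_arc_sym arc2) _ _ _ _ _.
  - by move=> e; rewrite e x2r ltxx in p1r.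
  - by move=> e; rewrite -e x2r ltxx in p2r.
  - by move=> /s2.
  - by case=> [/s1//|e|/seg_in]; [rewrite e x1r ltxx in p2r|lra].
  - move=> z /= [/s1 /A12 + /s2//|->|/seg_in].
      by move=> /out2; rewrite x1r ltxx.
    by move=> zr /out2; lra.
suff <- : [set z | [\/ [set z | [\/ A1' z, z = x1 | open_segment x1 x2 z]] z, z = x2 | A2' z]]
    = through A1' x1 x2 A2' by [].
apply/seteqP; split=> z /=.
- case=> [[|->|[t t01 <-]]|->|].
  + by constructor 1.
  + by constructor 2; exists 0; rewrite ?lerp0 //; lra.
  + by constructor 2; exists t => //; lra.
  + by constructor 2; exists 1; rewrite ?lerp1 //; lra.
  + by constructor 3.
- case=> [|[t t01 <-]|].
  + by move=> z1; constructor 1; constructor 1.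
  + have [t0|t0] := ltP 0 t; last first.
      by constructor 1; constructor 2; rewrite (_ : t = 0) ?lerp0 //; lra.
    have [t1|t1] := ltP t 1; last first.
      by constructor 2; rewrite (_ : t = 1) ?lerp1 //; lra.
    by constructor 1; constructor 3; exists t => //; lra.
  + by constructor 3.
Qed.

(** Tails are disjoint as parts of disjoint edges, a tail misses a chord by distance, and [sep] puts
    both ends of one chord strictly on one side of the line of the other. *)
Lemma through_disjoint c r A1 p1 A1' x1 A2 p2 A2' x2 A3 p3 A3' x3 A4 p4 A4' x4 z :
  stops_at c r A1 p1 A1' x1 -> stops_at c r A2 p2 A2' x2 ->
  stops_at c r A3 p3 A3' x3 -> stops_at c r A4 p4 A4' x4 ->
  (forall z, A1 z -> ~ A3 z) -> (forall z, A1 z -> ~ A4 z) ->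
  (forall z, A2 z -> ~ A3 z) -> (forall z, A2 z -> ~ A4 z) ->
  0 < orient x1 x2 x3 * orient x1 x2 x4 \/ 0 < orient x3 x4 x1 * orient x3 x4 x2 ->
  through A1' x1 x2 A2' z -> ~ through A3' x3 x4 A4' z.
Proof.
move=> [_ [_ s1] _ x1r o1] [_ [_ s2] _ x2r o2] [_ [_ s3] _ x3r o3] [_ [_ s4] _ x4r o4].
move=> A13 A14 A23 A24 sep.
case=> [z1|[t t01 tz]|z2] [z3|[s st01 sz]|z4].
- exact: A13 (s1 _ z1) (s3 _ z3).
- by have := o1 _ z1; rewrite -sz; have := closed_segment_disc st01 x3r x4r; lra.
- exact: A14 (s1 _ z1) (s4 _ z4).
- by have := o3 _ z3; rewrite -tz; have := closed_segment_disc t01 x1r x2r; lra.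
- case: sep => sep.
    by apply: (closed_segment_disjoint sep st01 (t := t)); rewrite tz sz.
  by apply: (closed_segment_disjoint sep t01 (t := s)); rewrite tz sz.
- by have := o4 _ z4; rewrite -tz; have := closed_segment_disc t01 x1r x2r; lra.
- exact: A23 (s2 _ z2) (s3 _ z3).
- by have := o2 _ z2; rewrite -sz; have := closed_segment_disc st01 x3r x4r; lra.
- exact: A24 (s2 _ z2) (s4 _ z4).
Qed.

Lemma stops_at_ex c r A p : open_arc A p c -> 0 < r -> r < dist2 p c ->
  exists A' x, stops_at c r A p A' x.
Proof.
move=> arc r0 pr; have [|A' [x [h1 h2 h3 h4 h5]]] := first_hit (c := c) arc pr.
  by rewrite dist2_center.
by exists A', x; split.
Qed.
End Chords.

Section Bypass.
Variables (W : finType) (G : multigraph W) (w : W) (K : finType) (a b : K -> W).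

(** All edges at [w], loops included, are dropped. [K] indexes the new ones: [void], [unit] or
    [bool] when 0, 2 or 4 edges other than loops meet [w]. *)
Definition bypass_edge : finType := ({e in [pred e : edge G | w \notin ends G e]} + K)%type.

Definition bypass_ends (e : bypass_edge) : {set W} :=
  match e with inl e => ends G (val e) | inr k => [set a k; b k]%SET end.

Lemma bypass_ends_card e : (0 < #|bypass_ends e| <= 2)%N.
Proof. by case: e => [e|k] /=; [exact: ends_card|rewrite cards2; case: (_ == _)]. Qed.

Definition bypass : multigraph W := Multigraph bypass_ends_card.

Variables (x y : K -> edge G).
Hypothesis x_ends : forall k, ends G (x k) = [set w; a k]%SET.
Hypothesis y_ends : forall k, ends G (y k) = [set w; b k]%SET.
Hypothesis xy_sum : forall F : edge G -> nat,
  (\sum_(e | (w \in ends G e) && (ends G e != [set w]%SET)) F e =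
   \sum_k (F (x k) + F (y k)))%N.

(** [xy_sum] says, in the form of sums, that the [x k] and [y k] list each non-loop edge at [w]
    exactly once. The new edge [k] therefore contributes at [v] what [x k] and [y k] did, and loops
    at [w] contributed nothing. *)
Lemma degree_bypass v : v != w -> degree bypass v = degree G v.
Proof.
move=> vw; rewrite !degree_sum big_sumType /=.
rewrite -(big_sub _ (fun e => incidence (ends G e) v)).
rewrite [RHS](bigID (fun e => w \in ends G e)) addnC /=; congr addn.
rewrite [RHS](bigID (fun e => ends G e == [set w]%SET)) /=.
rewrite [X in _ = (X + _)%N]big1 ?add0n; last first.
  move=> e /andP[_ /eqP->].
  by rewrite -[[set w]%SET]finset.setUid incidence2 (negbTE vw).
rewrite xy_sum; apply: eq_bigr => k _.
by rewrite x_ends y_ends !incidence2 (negbTE vw).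
Qed.

Variables (R : realType) (S : {set W}) (pos : W -> R * R) (A : edge G -> set (R * R)).
Variable B : K -> set (R * R).

Definition bypass_arcs (e : edge bypass) : set (R * R) :=
  match e with inl e => A (val e) | inr k => B k end.

Lemma drawing_bypass : drawing_on S pos A ->
  (forall k, [/\ a k != w, b k != w & open_arc (B k) (pos (a k)) (pos (b k))]) ->
  (forall k v, v \in S -> v != w -> ~ B k (pos v)) ->
  (forall k e z, w \notin ends G e -> B k z -> ~ A e z) ->
  (forall k l z, B k z -> B l z -> k = l) ->
  drawing_on (S :\ w)%SET pos bypass_arcs.
Proof.
move=> dr Bk Bv BA BB; have [pinj _ Av AA] := dr; split.
- by move=> u v /setD1P[_ uS] /setD1P[_ vS]; exact: pinj.
- case=> [[e /= we]|k].
    have [u [v uv]] := ends_pair e; exists u, v.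
    have [uS vS arc] := drawing_arc dr uv.
    move: we; rewrite inE uv !inE negb_or !(eq_sym w) => /andP[uw vw].
    by rewrite uw vw.
  have [aw bw arc] := Bk k; exists (a k), (b k).
  have [_ aS _] := drawing_arc dr (x_ends k).
  have [_ bS _] := drawing_arc dr (y_ends k).
  by split=> //; apply/setD1P.
- by case=> [e|k] v /setD1P[vw vS] /=; [exact: Av|exact: Bv].
- case=> [e|k] [e'|l] z /=.
  + by move=> /AA h /h /val_inj->.
  + by move=> h1 /(BA _ _ _ (valP e)).
  + by move=> /(BA _ _ _ (valP e')).
  + by move=> /BB h /h->.
Qed.

End Bypass.

(** * Eliminating the vertices outside the subgraph *)

Section RemoveVertex.
Variable R : realType.

(** The injection [h] records that every edge avoiding [w] survives with its ends; this carries the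
    edges of [H] along. *)
Definition vertex_removed (W : finType) (G : multigraph W) (S : {set W}) (w : W)
    (pos : W -> R * R) : Prop :=
  exists (G' : multigraph W) (A' : edge G' -> set (R * R))
    (h : {e in [pred e : edge G | w \notin ends G e]} -> edge G'),
  [/\ drawing_on (S :\ w)%SET pos A',
    forall v, v != w -> degree G' v = degree G v,
    injective h
  & forall e, ends G' (h e) = ends G (val e)].

Variables (W : finType) (G : multigraph W) (S : {set W}) (w : W).
Variables (pos : W -> R * R) (A : edge G -> set (R * R)).
Hypotheses (dr : drawing_on S pos A) (wS : w \in S).

Let nonloop := [pred e : edge G | (w \in ends G e) && (ends G e != [set w]%SET)].

Lemma nonloop_other e : nonloop e -> exists a, [/\ a != w, ends G e = [set w; a]%SET,
  a \in S & open_arc (A e) (pos a) (pos w)].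
Proof.
move=> /andP[we nl]; suff [a [aw ewa]] : exists a, a != w /\ ends G e = [set w; a]%SET.
  have [_ aS arc] := drawing_arc dr ewa.
  by exists a; split=> //; exact: open_arc_sym.
have [u [v uv]] := ends_pair e.
move: we nl; rewrite uv !inE => /orP[]/eqP<- nl.
  by exists v; split=> //; apply: contraNneq nl => ->; rewrite finset.setUid.
exists u; rewrite finset.setUC; split=> //.
by apply: contraNneq nl => ->; rewrite finset.setUid.
Qed.

(** With [w] gone, the point [pos w] is free to become an inner point of the new edge. If [a1 = a2],
    that edge is a loop. *)
Lemma bypass_two e1 e2 : e1 != e2 -> nonloop e1 -> nonloop e2 ->
  (forall F : edge G -> nat, (\sum_(e | nonloop e) F e = F e1 + F e2)%N) ->
  vertex_removed G S w pos.
Proof.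
move=> e12 n1 n2 sumF; have [pinj _ Av AA] := dr.
have [a1 [a1w E1 a1S arc1]] := nonloop_other n1.
have [a2 [a2w E2 a2S /open_arc_sym arc2]] := nonloop_other n2.
have xyF (F : edge G -> nat) : (\sum_(e | nonloop e) F e = \sum_(k : unit) (F e1 + F e2))%N.
  by rewrite sumF big_const card_unit /= addn0.
pose B (_ : unit) := [set z | [\/ A e1 z, z = pos w | A e2 z]].
exists (bypass G w (fun _ : unit => a1) (fun _ => a2)).
exists (bypass_arcs A B), inl; split=> //; last by move=> ? ? [].
  apply: (@drawing_bypass _ _ _ _ _ _ (fun _ => e1) (fun _ => e2)) => //.
  - case; split=> //; apply: open_arc_concat arc1 arc2 _ _ _ _ _.
    + by move=> /pinj e; rewrite e ?eqxx in a1w.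
    + by move=> /pinj e; rewrite -e ?eqxx in a2w.
    + exact: Av.
    + exact: Av.
    + by move=> z z1 /(AA _ _ _ z1) e; rewrite e eqxx in e12.
  - case=> v vS vw [|/pinj e|]; [exact: Av| |exact: Av].
    by rewrite e ?eqxx in vw.
  - case=> e z we [z1|->|z2].
    + by move=> /(AA _ _ _ z1) ee; case/negP: we; rewrite -ee; case/andP: n1.
    + exact: Av.
    + by move=> /(AA _ _ _ z2) ee; case/negP: we; rewrite -ee; case/andP: n2.
  - by move=> [] [].
by move=> v; apply: (@degree_bypass _ _ _ _ _ _ (fun _ => e1) (fun _ => e2)).
Qed.

(** Joins [e1] with [e2] and [e3] with [e4]; the other pairing is obtained by exchanging [e2] and
    [e3]. *)
Lemma bypass_four_chords r e1 e2 e3 e4 a1 a2 a3 a4 A1 A2 A3 A4 x1 x2 x3 x4 :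
  uniq [:: e1; e2; e3; e4] ->
  (forall z, dist2 z (pos w) <= r -> (forall e, w \notin ends G e -> ~ A e z) /\
     (forall v, v \in S -> v != w -> z <> pos v)) ->
  [/\ a1 != w, a2 != w, a3 != w & a4 != w] ->
  [/\ ends G e1 = [set w; a1], ends G e2 = [set w; a2],
      ends G e3 = [set w; a3] & ends G e4 = [set w; a4]]%SET ->
  stops_at (pos w) r (A e1) (pos a1) A1 x1 ->
  stops_at (pos w) r (A e2) (pos a2) A2 x2 ->
  stops_at (pos w) r (A e3) (pos a3) A3 x3 ->
  stops_at (pos w) r (A e4) (pos a4) A4 x4 ->
  0 < orient x1 x2 x3 * orient x1 x2 x4 \/ 0 < orient x3 x4 x1 * orient x3 x4 x2 ->
  (forall F : edge G -> nat, (\sum_(e | nonloop e) F e = F e1 + F e2 + (F e3 + F e4))%N) ->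
  vertex_removed G S w pos.
Proof.
move=> /=; rewrite !inE !negb_or => /and4P[/and3P[e12 e13 e14] /andP[e23 e24] e34 _].
move=> disc [a1w a2w a3w a4w] [E1 E2 E3 E4] st1 st2 st3 st4 sep sumF.
have [pinj _ Av AA] := dr.
have dis e e' : e != e' -> forall z, A e z -> ~ A e' z.
  by move=> ee z z1 /(AA _ _ _ z1) E; rewrite E eqxx in ee.
pose x (k : bool) := if k then e1 else e3.
pose y (k : bool) := if k then e2 else e4.
pose a k := if k then a1 else a3.
pose b k := if k then a2 else a4.
pose B k := if k then through A1 x1 x2 A2 else through A3 x3 x4 A4.
have Bsub k z : B k z -> [\/ A (x k) z, dist2 z (pos w) <= r | A (y k) z].
  by case: k; [exact: (through_sub st1 st2)|exact: (through_sub st3 st4)].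
have Ex k : ends G (x k) = [set w; a k]%SET by case: k.
have Ey k : ends G (y k) = [set w; b k]%SET by case: k.
have xyF (F : edge G -> nat) : (\sum_(e | nonloop e) F e = \sum_k (F (x k) + F (y k)))%N.
  by rewrite sumF big_bool.
have aS k : a k \in S by have [] := drawing_arc dr (Ex k).
have bS k : b k \in S by have [] := drawing_arc dr (Ey k).
have BB z : B true z -> ~ B false z.
  by apply: (through_disjoint st1 st2 st3 st4) => //; apply: dis.
exists (bypass G w a b), (bypass_arcs A B), inl; split=> //; last by move=> ? ? [].
  apply: (@drawing_bypass _ _ _ _ _ _ x y) => //.
  - move=> k; split; [by case: k|by case: k|].
    have := aS k; have := bS k; case: k => /= bkS akS.
    + by apply: (open_arc_through st1 st2); [exact: dis|exact: Av|exact: Av].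
    + by apply: (open_arc_through st3 st4); [exact: dis|exact: Av|exact: Av].
  - move=> k v vS vw /Bsub[|/disc[_ /(_ v vS vw)]//|]; exact: Av.
  - move=> k e z we /Bsub[z1|/disc[/(_ _ we)]//|z2].
    + by move=> /(AA _ _ _ z1) ee; move: we; rewrite -ee Ex !inE eqxx.
    + by move=> /(AA _ _ _ z2) ee; move: we; rewrite -ee Ey !inE eqxx.
  - case=> [] [] // z; first by move=> /BB.
    by move=> z1 /BB /(_ z1).
by move=> v; apply: (@degree_bypass _ _ _ _ _ _ x y).
Qed.

(** Finitely many vertices and edges have to be avoided, so one disc around [pos w] is clear of them
    all. The four points on its circle are distinct because they lie on different edges. *)
Lemma bypass_four e1 e2 e3 e4 : uniq [:: e1; e2; e3; e4] ->
  nonloop e1 -> nonloop e2 -> nonloop e3 -> nonloop e4 ->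
  (forall F : edge G -> nat, (\sum_(e | nonloop e) F e = F e1 + F e2 + (F e3 + F e4))%N) ->
  vertex_removed G S w pos.
Proof.
move=> u4 n1 n2 n3 n4 sumF; have [pinj _ Av AA] := dr.
have [a1 [a1w E1 a1S arc1]] := nonloop_other n1.
have [a2 [a2w E2 a2S arc2]] := nonloop_other n2.
have [a3 [a3w E3 a3S arc3]] := nonloop_other n3.
have [a4 [a4w E4 a4S arc4]] := nonloop_other n4.
have n1' : \forall z \near pos w, forall e, w \notin ends G e -> ~ A e z.
  suff h e : \forall z \near pos w, w \notin ends G e -> ~ A e z by exact: filter_forall h.
  have [we|we] := boolP (w \in ends G e).
    by near=> z.
  suff : \forall z \near pos w, ~ A e z by apply: filterS.
  have [u [v uv]] := ends_pair e; have [uS vS arc] := drawing_arc dr uv.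
  move: we; rewrite uv !inE negb_or => /andP[wu wv].
  apply: near_open_arcC arc _ _ _; first exact: Av.
  - by move=> /pinj E; rewrite E ?eqxx in wu.
  - by move=> /pinj E; rewrite E ?eqxx in wv.
have n2' : \forall z \near pos w, forall v, v \in S -> v != w -> z <> pos v.
  suff h v : \forall z \near pos w, v \in S -> v != w -> z <> pos v.
    exact: filter_forall h.
  have [vS|vS] := boolP (v \in S); last by near=> z.
  have [vw|vw] := eqVneq v w; first by near=> z.
  suff : \forall z \near pos w, z <> pos v by apply: filterS.
  by apply: near_neq => /pinj E; rewrite E ?eqxx in vw.
have [r r0 disc] := near_disc (filterI n1' n2').
have far v : v \in S -> v != w -> r < dist2 (pos v) (pos w).
  by move=> vS vw; rewrite ltNge; apply/negP => /disc[_ /(_ v vS vw)].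
have [A1 [x1 st1]] := stops_at_ex arc1 r0 (far _ a1S a1w).
have [A2 [x2 st2]] := stops_at_ex arc2 r0 (far _ a2S a2w).
have [A3 [x3 st3]] := stops_at_ex arc3 r0 (far _ a3S a3w).
have [A4 [x4 st4]] := stops_at_ex arc4 r0 (far _ a4S a4w).
have neq e e' x x' : e != e' -> A e x -> A e' x' -> x <> x'.
  by move=> ee z1 z2 xx; rewrite -xx in z2; rewrite (AA _ _ _ z1 z2) eqxx in ee.
have [_ _ X1 c1 _] := st1; have [_ _ X2 c2 _] := st2.
have [_ _ X3 c3 _] := st3; have [_ _ X4 c4 _] := st4.
have := u4; rewrite /= !inE !negb_or => /and4P[/and3P[e12 e13 e14] /andP[e23 e24] e34 _].
have [sep|sep] := circle_pairing c1 c2 c3 c4 (neq _ _ _ _ e12 X1 X2)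
  (neq _ _ _ _ e13 X1 X3) (neq _ _ _ _ e14 X1 X4) (neq _ _ _ _ e23 X2 X3)
  (neq _ _ _ _ e24 X2 X4) (neq _ _ _ _ e34 X3 X4).
- by apply: (bypass_four_chords u4 disc _ _ st1 st2 st3 st4 sep sumF).
- apply: (bypass_four_chords _ disc _ _ st1 st3 st2 st4 sep) => //.
    by rewrite /= !inE !negb_or e12 e13 e14 e24 e34 eq_sym e23.
  by move=> F; rewrite sumF addnACA.
Unshelve. all: by end_near.
Qed.

Lemma remove_vertex : degree G w = 4%N -> vertex_removed G S w pos.
Proof.
move=> deg4; have sumF F : (\sum_(e | nonloop e) F e = \sum_(e <- enum nonloop) F e)%N.
  by rewrite big_enum.
have enumP e : e \in enum nonloop -> nonloop e by rewrite mem_enum.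
have uE := enum_uniq nonloop.
(* A loop counts twice in the degree, so the number of remaining edges is even and at most 4. *)
have parity : (#|nonloop| + #|[pred e | ends G e == [set w]%SET]|.*2 = 4)%N.
  rewrite -deg4 /degree -addnn addnA; congr addn.
  rewrite -(cardID [pred e | ends G e == [set w]%SET] [pred e | w \in ends G e]) addnC.
  congr addn; apply: eq_card => e; rewrite !inE.
    by case: eqP => [->|]; rewrite ?inE ?eqxx ?andbF ?andbT.
  by rewrite andbC.
move: parity; rewrite cardE; case: (enum nonloop) sumF enumP uE => [|e1 [|e2 [|e3 [|e4 [|e5 s]]]]].
- move=> sumF _ _ _.
  exists (bypass G w (of_void W) (of_void W)).
  exists (bypass_arcs A (of_void _)), inl; split=> //; last by move=> ? ? [].
    by apply: (@drawing_bypass _ _ _ _ _ _ (of_void _) (of_void _)) => // -[].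
  move=> v; apply: (@degree_bypass _ _ _ _ _ _ (of_void _) (of_void _)) => [[]|[]|F].
  by rewrite sumF big_nil big1 // => -[].
- by move=> _ _ _ /=; lia.
- move=> sumF nl /=; rewrite inE andbT => e12 _.
  apply: (@bypass_two e1 e2) => //; try by apply: nl; rewrite !inE eqxx ?orbT.
  by move=> F; rewrite sumF !big_cons big_nil addn0.
- by move=> _ _ _ /=; lia.
- move=> sumF nl u4 _.
  apply: (@bypass_four e1 e2 e3 e4) => //; try by apply: nl; rewrite !inE eqxx ?orbT.
  by move=> F; rewrite sumF !big_cons big_nil addn0 !addnA.
- by move=> _ _ _ /=; lia.
Qed.

End RemoveVertex.

Lemma remove_all_vertices (R : realType) (V W : finType) (H : multigraph V) (f : V -> W)
    (pos : W -> R * R) n (S : {set W}) (G : multigraph W) (A : edge G -> set (R * R)) :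
  #|S :\: [set f v | v : V]%SET| = n -> [set f v | v : V]%SET \subset S ->
  drawing_on S pos A -> (forall v, v \in S -> degree G v = 4%N) -> subgraph_via f H G ->
  exists (G' : multigraph W) (A' : edge G' -> set (R * R)),
    [/\ drawing_on [set f v | v : V]%SET pos A', forall v, degree G' (f v) = 4%N
      & subgraph_via f H G'].
Proof.
elim: n S G A => [|n IH] S G A cS fS dr deg sub.
  have SE : S = [set f v | v : V]%SET.
    apply/eqP; rewrite finset.eqEsubset fS andbT -finset.setD_eq0 -cards_eq0.
    by rewrite cS.
  rewrite -SE; exists G, A; split=> // v; apply: deg.
  by rewrite SE; apply: imset_f.
have [w] : exists w, w \in S :\: [set f v | v : V]%SET.
  by apply/card_gt0P; rewrite cS.
move=> /[dup] wD; rewrite inE => /andP[wf wS].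
have [G' [A' [h [dr' deg' hinj hE]]]] := remove_vertex dr wS (deg w wS).
have [finj [g ginj gE]] := sub.
apply: (IH _ G' A' _ _ dr').
- rewrite finset.setDDl finset.setUC -finset.setDDl.
  by move: cS; rewrite (cardsD1 w) wD add1n => -[].
- by rewrite subsetD1 fS.
- by move=> v /setD1P[vw vS]; rewrite deg' // deg.
(* Edges of [H] have their ends in the image of [f], which does not contain [w]. *)
- have away e : g e \in [pred e | w \notin ends G e].
    rewrite inE gE; apply: contra wf => /imsetP[v _ ->]; exact: imset_f.
  split=> //; exists (fun e => h (exist _ (g e) (away e))).
    by move=> e e' /hinj[/ginj].
  by move=> e; rewrite hE /= gE.
Qed.

(** Once the vertices outside the image of [f] are eliminated, all edges end in that image; taking
    preimages of end sets moves the multigraph to [V] with the same arcs. *)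
Lemma spanning_of_simple (R : realType) (V W : finType) (H : multigraph V)
    (G : multigraph W) : regular 4 G -> planar R G -> subgraph H G ->
  exists G' : multigraph V, [/\ regular 4 G', planar R G' & spanning_subgraph H G'].
Proof.
move=> reg /planar_drawing_on[pos [A dr]] [f sub].
have [|v _|G1 [A1 [dr1 deg1 [finj [g ginj gE]]]]] :=
  remove_all_vertices (erefl _) _ dr _ sub; [exact: finset.subsetT|exact: reg|].
have f1 e v1 : v1 \in ends G1 e -> exists v, v1 = f v.
  have [u [v uv]] := ends_pair e; have [uS vS _] := drawing_arc dr1 uv.
  rewrite uv !inE => /orP[]/eqP->.
    by have /imsetP[x _ ->] := uS; exists x.
  by have /imsetP[x _ ->] := vS; exists x.
have endsE e : ends G1 e = [set f v | v in f @^-1: ends G1 e]%SET.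
  apply/setP => z; apply/idP/imsetP => [/[dup] ze /f1[v zv]|[v]].
    by exists v; rewrite // inE -zv.
  by rewrite inE => ? ->.
have cE e : #|f @^-1: ends G1 e| = #|ends G1 e|.
  by rewrite [in RHS]endsE card_imset.
have card e : (0 < #|f @^-1: ends G1 e| <= 2)%N by rewrite cE ends_card.
exists (Multigraph card); split.
- move=> v; rewrite -(deg1 v) /degree; congr addn; apply: eq_card => e; rewrite !inE //=.
  rewrite [in RHS]endsE -(imset_set1 f v) (inj_eq (imset_inj finj)) //.
- apply/planar_drawing_on; exists (pos \o f), A1.
  have [pinj _ Av AA] := dr1; split=> //.
  + by move=> u v _ _ /= /pinj E; apply: finj; apply: E; exact: imset_f.
  + move=> e /=; have [u [v uv]] := ends_pair (G := Multigraph card) e.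
    exists u, v; split; rewrite ?inE //.
    have uv1 : ends G1 e = [set f u; f v]%SET.
      by rewrite endsE; move: uv => /= ->; rewrite imsetU1 imset_set1.
    by have [] := drawing_arc dr1 uv1.
  + by move=> e v _; apply: Av; exact: imset_f.
- split; first by [].
  exists g => // e; apply/setP => v /=; rewrite inE gE (mem_imset _ _ finj).
  by rewrite imset_id.
Qed.

(** * The octahedron gadget *)

(* The octahedron without the edge 01, vertices 0 to 5, and two further points
   6 and 7 joined to 0 and 1; the coordinates refer to the affine frame with
   origin 6 in which 7 is (7, 0). *)
Definition gadget_points : seq (nat * nat) :=
  [:: (0, 2); (2, 4); (3, 1); (2, 3); (1, 2); (1, 4); (0, 0); (7, 0)]%N.

(** The antipodal pairs of the octahedron are 03, 14 and 25. Every edge has its target among 0 to 5,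
    and only the last two, numbered 11 and 12, start at the outer points 6 and 7. *)
Definition gadget_edges : seq (nat * nat) :=
  [:: (1, 2); (2, 0); (3, 4); (4, 5); (5, 3); (0, 4); (0, 5); (1, 3); (1, 5);
      (2, 3); (2, 4); (6, 0); (7, 1)]%N.

Definition gpoint i := nth (0, 0)%N gadget_points i.
Definition gsrc k := (nth (0, 0)%N gadget_edges k).1.
Definition gtgt k := (nth (0, 0)%N gadget_edges k).2.

(** [orient] on integer coordinates, so that every incidence and separation claim about the gadget
    is a finite computation. *)
Definition gorient i j k : int :=
  let: (a, b, c) := (gpoint i, gpoint j, gpoint k) in
  (b.1%:Z - a.1%:Z) * (c.2%:Z - a.2%:Z) - (b.2%:Z - a.2%:Z) * (c.1%:Z - a.1%:Z).

Definition gseparates k l : bool :=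
  let m := gorient (gsrc k) (gtgt k) (gsrc l) in
  let n := gorient (gsrc k) (gtgt k) (gtgt l) in
  (0 <= m * n) && ((m != 0) || (n != 0)).

Lemma all_iotaP (P : nat -> bool) n : all P (iota 0 n) -> forall i, (i < n)%N -> P i.
Proof. by move=> /allP h i ilt; apply: h; rewrite mem_iota. Qed.

Lemma gadget_edges_bounds k : (k < 13)%N ->
  [&& gtgt k < 6, gsrc k < 8, gsrc k != gtgt k, (gsrc k == 6) == (k == 11)
    & (gsrc k == 7) == (k == 12)]%N.
Proof. by apply: (@all_iotaP (fun k => _)); vm_compute. Qed.

(** The triangle is the one spanned by 6, 7 and the third frame point [(0, 7)]. A positive second
    coordinate gives that frame point positive weight, which puts the vertices strictly inside the
    disc. *)
Lemma gadget_points_triangle i : (i < 6)%N ->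
  (0 < (gpoint i).2)%N && ((gpoint i).1 + (gpoint i).2 <= 7)%N.
Proof. by apply: (@all_iotaP (fun k => _)); vm_compute. Qed.

Lemma gpoint_inj i j : (i < 8)%N -> (j < 8)%N -> gpoint i = gpoint j -> i = j.
Proof. by move=> i8 j8 /eqP; rewrite nth_uniq // => /eqP. Qed.

Lemma gorient_neq0 k i : (k < 13)%N -> (i < 8)%N -> i != gsrc k -> i != gtgt k ->
  gorient (gsrc k) (gtgt k) i != 0.
Proof.
move=> k13 i8 ns nt.
have : all (fun k => all (fun i => [|| i == gsrc k, i == gtgt k
    | gorient (gsrc k) (gtgt k) i != 0]) (iota 0 8)) (iota 0 13) by vm_compute.
by move=> /all_iotaP/(_ k k13)/all_iotaP/(_ i i8); rewrite (negbTE ns) (negbTE nt).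
Qed.

(** Sometimes only one of the two lines separates, hence both orders. *)
Lemma gseparates_or k l : (k < 13)%N -> (l < 13)%N -> k != l ->
  gseparates k l || gseparates l k.
Proof.
move=> k13 l13 kl.
have : all (fun k => all (fun l => [|| k == l, gseparates k l | gseparates l k])
    (iota 0 13)) (iota 0 13) by vm_compute.
by move=> /all_iotaP/(_ k k13)/all_iotaP/(_ l l13); rewrite (negbTE kl).
Qed.

(** Only inner ends are compared, because 6 and 7 will become the ends of the replaced edge, which
    may coincide. *)
Lemma gadget_edges_inj k l : (k < 13)%N -> (l < 13)%N ->
  (forall i, (i < 6)%N -> ((i == gsrc k) || (i == gtgt k)) = ((i == gsrc l) || (i == gtgt l))) ->
  k = l.
Proof.
move=> k13 l13 kl; apply/eqP.
have : all (fun k => all (fun l =>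
    all (fun i => ((i == gsrc k) || (i == gtgt k)) == ((i == gsrc l) || (i == gtgt l))) (iota 0 6)
    ==> (k == l)) (iota 0 13)) (iota 0 13) by vm_compute.
move=> /all_iotaP/(_ k k13)/all_iotaP/(_ l l13)/implyP; apply.
by apply/allP => i; rewrite mem_iota => i6; apply/eqP/kl.
Qed.

(** Degrees in the gadget: 4 at the inner vertices, 1 at each of 6 and 7, which restores what the
    ends of the replaced edge lose. *)
Lemma gadget_sum (F : nat -> nat) :
  (\sum_(k < 13) (F (gsrc k) + F (gtgt k)) =
   4 * (F 0 + F 1 + F 2 + F 3 + F 4 + F 5) + F 6 + F 7)%N.
Proof. by rewrite !big_ord_recl big_ord0 /gsrc /gtgt /=; lia. Qed.

Section GadgetGeometry.
Variable R : realType.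
Variables (P1 P2 Q c : R * R) (r : R).
Hypotheses (P1r : dist2 P1 c = r) (P2r : dist2 P2 c = r) (Qr : dist2 Q c < r).
Hypothesis frame : orient P1 P2 Q != 0.

(** The affine map sending [(0, 0)], [(7, 0)] and [(0, 7)] to [P1], [P2] and [Q]. *)
Definition gmap i : R * R :=
  let x := (gpoint i).1%:R / 7 in let y := (gpoint i).2%:R / 7 in
  (P1.1 + x * (P2.1 - P1.1) + y * (Q.1 - P1.1),
   P1.2 + x * (P2.2 - P1.2) + y * (Q.2 - P1.2)).

Lemma gmap6 : gmap 6 = P1.
Proof. by rewrite /gmap /= !mul0r !addr0; case: P1. Qed.

Lemma gmap7 : gmap 7 = P2.
Proof.
rewrite /gmap /= divff ?pnatr_eq0 // !mul0r !mul1r !addr0.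
by rewrite !(addrC P1.1) !(addrC P1.2) !subrK; case: P2.
Qed.

(** An affine map multiplies signed areas by its determinant; 49 comes from the two scalings by
    7. *)
Lemma orient_gmap i j k :
  orient (gmap i) (gmap j) (gmap k) = (gorient i j k)%:~R * (orient P1 P2 Q / 49).
Proof.
rewrite /gorient rmorphB !rmorphM !rmorphB /= -!pmulrn /orient /gmap /=.
by field.
Qed.

Lemma gmap_inj i j : (i < 8)%N -> (j < 8)%N -> gmap i = gmap j -> i = j.
Proof.
move=> i8 j8 ij; apply: gpoint_inj => //.
have e2 k : orient P1 P2 (gmap k) = (gpoint k).2%:R * (orient P1 P2 Q / 7).
  by rewrite /orient /gmap /=; field.
have e1 k : orient P1 Q (gmap k) = - (gpoint k).1%:R * (orient P1 P2 Q / 7).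
  by rewrite /orient /gmap /=; field.
have n0 : orient P1 P2 Q / 7 != 0 by rewrite mulf_neq0 // invr_neq0 // pnatr_eq0.
have := e2 i; rewrite ij e2 => /(mulIf n0)/eqP; rewrite eqr_nat => /eqP h2.
have := e1 i; rewrite ij e1 => /(mulIf n0)/oppr_inj/eqP; rewrite eqr_nat => /eqP h1.
by rewrite (surjective_pairing (gpoint i)) (surjective_pairing (gpoint j)) h1 h2.
Qed.

Lemma gmap_disc i : (i < 6)%N -> dist2 (gmap i) c < r.
Proof.
move=> /gadget_points_triangle; rewrite /gmap.
case: (gpoint i) => x y /= /andP[y0 xy7].
have {}y0 : 0 < y%:R :> R by rewrite ltr0n.
have x0 : 0 <= x%:R :> R by rewrite ler0n.
have {}xy7 : x%:R + y%:R <= 7%:R :> R by rewrite -natrD ler_nat.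
have [s0 [t0 st]] : 0 <= x%:R / 7%:R :> R /\ 0 < y%:R / 7%:R :> R /\
    x%:R / 7%:R + y%:R / 7%:R <= 1 :> R by split; [|split]; lra.
move: s0 t0 st; move: (x%:R / 7%:R) (y%:R / 7%:R) => s t s0 t0 st.
(* Stewart's identity for three points: the subtracted terms are nonnegative, and [Q], of weight
   [t > 0], is strictly inside the disc. *)
have -> : forall p q u : R * R, dist2 (p.1 + s * (q.1 - p.1) + t * (u.1 - p.1),
     p.2 + s * (q.2 - p.2) + t * (u.2 - p.2)) c =
   (1 - s - t) * dist2 p c + s * dist2 q c + t * dist2 u c
   - ((1 - s - t) * s * dist2 p q + (1 - s - t) * t * dist2 p u + s * t * dist2 q u).
  by move=> p q u; rewrite /dist2 /=; ring.
have h : 0 <= 1 - s - t by lra.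
have d1 : 0 <= (1 - s - t) * s * dist2 P1 P2 by rewrite !mulr_ge0 ?dist2_ge0.
have d2 : 0 <= (1 - s - t) * t * dist2 P1 Q by rewrite !mulr_ge0 ?dist2_ge0 // ltW.
have d3 : 0 <= s * t * dist2 P2 Q by rewrite !mulr_ge0 ?dist2_ge0 // ltW.
have d4 : t * dist2 Q c < t * r by rewrite ltr_pM2l.
rewrite P1r P2r; lra.
Qed.

Lemma gmap_disc_le i : (i < 8)%N -> dist2 (gmap i) c <= r.
Proof.
case: (ltnP i 6) => [i6 _|i6 i8]; first exact/ltW/gmap_disc.
have [->|->] : i = 6%N \/ i = 7%N by lia.
  by rewrite gmap6 P1r.
by rewrite gmap7 P2r.
Qed.

Definition gsegment k := open_segment (gmap (gsrc k)) (gmap (gtgt k)).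

Lemma gadget_bounds8 k : (k < 13)%N -> [/\ (gsrc k < 8)%N, (gtgt k < 8)%N & gsrc k <> gtgt k].
Proof.
move=> /gadget_edges_bounds/and5P[t6 s8 /eqP st _ _]; split=> //.
exact: leq_trans t6 _.
Qed.

Lemma gsegment_neq k : (k < 13)%N -> gmap (gsrc k) <> gmap (gtgt k).
Proof. by move=> /gadget_bounds8[s8 t8 st] /gmap_inj => /(_ s8 t8). Qed.

Lemma open_arc_gsegment k : (k < 13)%N ->
  open_arc (gsegment k) (gmap (gsrc k)) (gmap (gtgt k)).
Proof. by move=> k13; apply: open_arc_segment; exact: gsegment_neq. Qed.

Lemma gsegment_disc k z : (k < 13)%N -> gsegment k z -> dist2 z c < r.
Proof.
move=> k13; have [s8 t8 _] := gadget_bounds8 k13.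
by apply: open_segment_disc; [exact: gsegment_neq|exact: gmap_disc_le..].
Qed.

Lemma gsegment_avoids k i : (k < 13)%N -> (i < 8)%N -> ~ gsegment k (gmap i).
Proof.
move=> k13 i8 ki; have arc := open_arc_gsegment k13.
have [e|ns] := eqVneq i (gsrc k); first by rewrite e in ki; exact: (open_arc_notin_l arc).
have [e|nt] := eqVneq i (gtgt k); first by rewrite e in ki; exact: (open_arc_notin_r arc).
have := gorient_neq0 k13 i8 ns nt.
case: ki => t _ e; have := orient_lerp_line (gmap (gsrc k)) (gmap (gtgt k)) t.
rewrite [X in orient _ _ X]e orient_gmap => /eqP.
rewrite !mulf_eq0 invr_eq0 intr_eq0 (negbTE frame).
by rewrite pnatr_eq0 orbF => ->.
Qed.

Lemma gsegment_disjoint k l z : (k < 13)%N -> (l < 13)%N -> k != l ->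
  gsegment k z -> ~ gsegment l z.
Proof.
have sep m n : gseparates m n -> gsegment m z -> ~ gsegment n z.
  move=> /andP[p0 n0]; apply: open_segment_disjoint; rewrite !orient_gmap.
    rewrite mulrACA -intrM mulr_ge0 ?ler0z // -expr2 sqr_ge0 //.
  have f0 : orient P1 P2 Q / 49 != 0 by rewrite mulf_neq0 // invr_neq0 // pnatr_eq0.
  by case/orP: n0 => n0; [left|right]; rewrite mulf_neq0 // intr_eq0.
move=> k13 l13 kl; case/orP: (gseparates_or k13 l13 kl) => h; first exact: sep h.
by move=> zk zl; exact: (sep _ _ h zl zk).
Qed.

End GadgetGeometry.

(** The centre [c], which is [Q 0], serves unless it lies on the line [P1 P2]; then it is moved
    perpendicularly by a quarter of the chord, which stays inside the disc. *)
Lemma frame_point (R : realType) (P1 P2 c : R * R) r : P1 <> P2 ->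
  dist2 P1 c = r -> dist2 P2 c = r ->
  exists Q, dist2 Q c < r /\ orient P1 P2 Q != 0.
Proof.
move=> P12 P1r P2r; have d0 := dist2_gt0 P12.
(* A chord is at most a diameter, by the parallelogram law. *)
have r0 : dist2 P1 P2 <= 4 * r.
  have h1 := sqr_ge0 (P1.1 + P2.1 - 2 * c.1); have h2 := sqr_ge0 (P1.2 + P2.2 - 2 * c.2).
  by move: P1r P2r; rewrite /dist2 => P1r P2r; nra.
pose Q k : R * R := (c.1 - k * (P2.2 - P1.2), c.2 + k * (P2.1 - P1.1)).
have Qd k : dist2 (Q k) c = k ^+ 2 * dist2 P1 P2 by rewrite /dist2 /=; ring.
have Qo k : orient P1 P2 (Q k) = orient P1 P2 c + k * dist2 P1 P2.
  by rewrite /orient /dist2 /=; ring.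
have [z0|z0] := eqVneq (orient P1 P2 (Q 0)) 0.
  exists (Q (1 / 4)); rewrite Qd; split; first lra.
  by move: z0; rewrite !Qo mul0r addr0 => ->; rewrite add0r mulf_neq0 ?gt_eqF // divr_gt0.
by exists (Q 0); rewrite Qd; split=> //; lra.
Qed.

(** * Replacing edges by gadgets *)

Section ReplaceEdge.
Variables (R : realType) (V : finType) (G : multigraph V) (e0 : edge G) (u v : V).
Hypothesis e0_ends : ends G e0 = [set u; v]%SET.

(** Combinatorially 6 and 7 are the ends of [e0]. In the drawing they are only the points where its
    loose ends stop, and the gadget edges 11 and 12 are prolonged by these loose ends. *)
Definition gvertex i : V + 'I_6 :=
  if (i < 6)%N then inr (inord i) else if i == 6%N then inl u else inl v.

Definition replaced_edge : finType := ({e in [pred e : edge G | e != e0]} + 'I_13)%type.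

Definition replaced_ends (e : replaced_edge) : {set (V + 'I_6)%type} :=
  match e with
  | inl e => [set inl x | x in ends G (val e)]%SET
  | inr k => [set gvertex (gsrc k); gvertex (gtgt k)]%SET
  end.

Lemma card_inl_ends e : #|[set (inl x : V + 'I_6) | x in ends G e]%SET| = #|ends G e|.
Proof. by rewrite card_imset // => ? ? []. Qed.

Lemma replaced_ends_card e : (0 < #|replaced_ends e| <= 2)%N.
Proof.
case: e => [e|k] /=; first by rewrite card_inl_ends ends_card.
by rewrite cards2; case: (_ == _).
Qed.

Definition replaced : multigraph (V + 'I_6)%type := Multigraph replaced_ends_card.

Lemma gvertex_inr i : (i < 6)%N -> gvertex i = inr (inord i).
Proof. by rewrite /gvertex => ->. Qed.

Lemma eq_gvertex_inr (i : 'I_6) j : (inr i == gvertex j) = (val i == j).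
Proof.
rewrite /gvertex; case: (ltnP j 6) => [j6|j6].
  by rewrite (inj_eq inr_inj) -val_eqE /= inordK.
have -> : (val i == j) = false.
  by apply/eqP => ij; have := ltn_ord i; rewrite -ij leqNgt ltn_ord in j6.
by case: ifP.
Qed.

Lemma degree_replaced : regular 4 G -> regular 4 replaced.
Proof.
move=> reg x; rewrite degree_sum big_sumType /=.
rewrite (eq_bigr (fun k : 'I_13 =>
  (x == gvertex (gsrc k)) + (x == gvertex (gtgt k)))%N); last first.
  by move=> k _; rewrite incidence2.
rewrite (gadget_sum (fun i => (x == gvertex i) : nat)).
rewrite -(big_sub _ (fun e => incidence [set inl y | y in ends G e]%SET x)).
case: x => [x|i].
  have inlE e : incidence [set (inl y : V + 'I_6) | y in ends G e]%SET (inl x) =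
      incidence (ends G e) x.
    rewrite /incidence (mem_imset _ _ (@inl_inj _ _)).
    by rewrite -imset_set1 (inj_eq (imset_inj (@inl_inj _ _))).
  have inl_neq i : (i < 6)%N -> (inl x == gvertex i) = false by move=> /gvertex_inr->.
  rewrite (eq_bigr _ (fun e _ => inlE e)) !(inl_neq 0%N, inl_neq 1%N, inl_neq 2%N,
    inl_neq 3%N, inl_neq 4%N, inl_neq 5%N) //.
  rewrite -[gvertex 6]/(inl u) -[gvertex 7]/(inl v) !(inj_eq (@inl_inj _ _)) -[RHS](reg x).
  rewrite degree_sum [RHS](bigD1 e0) //= e0_ends incidence2.
  by rewrite !addn0 muln0 add0n addnC.
rewrite big1 ?add0n => [|e _]; last first.
  have [y [z yz]] := ends_pair e.
  by rewrite yz imsetU1 imset_set1 incidence2.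
rewrite !eq_gvertex_inr /=; case: i => -[|[|[|[|[|[|i]]]]]] //.
Qed.

Lemma inr_in_replaced (i : 'I_6) (k : 'I_13) :
  (inr i \in replaced_ends (inr k)) = (val i == gsrc k) || (val i == gtgt k).
Proof. by rewrite /= !inE !eq_gvertex_inr. Qed.

Lemma replaced_inr_card (k : 'I_13) : #|replaced_ends (inr k)| = 2%N.
Proof.
have /and5P[t6 _ st _ _] := gadget_edges_bounds (ltn_ord k).
by rewrite /= cards2 (gvertex_inr t6) eq_sym eq_gvertex_inr /= inordK // eq_sym st.
Qed.

Lemma replaced_inr_inj (k l : 'I_13) :
  replaced_ends (inr k) = replaced_ends (inr l) -> k = l.
Proof.
move=> kl; apply/val_inj/gadget_edges_inj; [exact: ltn_ord|exact: ltn_ord|move=> i i6].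
by have := inr_in_replaced (Ordinal i6) k; rewrite kl inr_in_replaced => <-.
Qed.

(** A gadget edge has an inner vertex as its target, an old edge has none. *)
Lemma replaced_inl_inr e k : replaced_ends (inl e) <> replaced_ends (inr k).
Proof.
have /and5P[t6 _ _ _ _] := gadget_edges_bounds (ltn_ord k).
move=> /setP/(_ (inr (Ordinal t6))); rewrite inr_in_replaced eqxx orbT.
by move=> /imsetP[].
Qed.

(** Splitting [e0] at an inner point [c] gives two disjoint arcs ending at [c], even for a loop.
    Each is cut at its first hit of the circle around [c], and what [e0] does after these hits is
    discarded. *)
Lemma planar_replaced : planar R G -> planar R replaced.
Proof.
move=> /planar_drawing_on[pos [A dr]]; apply/planar_drawing_on.
have [pinj _ Av AA] := dr.
have [_ _ arc] := drawing_arc dr e0_ends.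
have [c [A1 [A2 [arc1 arc2 Ac [A1A A2A] A12]]]] := open_arc_split arc.
have cpos x : c <> pos x by move=> E; apply: (Av e0 x); rewrite ?inE // -E.
have n1 : \forall z \near c, forall e, e != e0 -> ~ A e z.
  suff h e : \forall z \near c, e != e0 -> ~ A e z by exact: filter_forall h.
  have [ee|ee] := eqVneq e e0; first by near=> z.
  suff : \forall z \near c, ~ A e z by apply: filterS.
  have [x [y xy]] := ends_pair e; have [_ _ arce] := drawing_arc dr xy.
  apply: near_open_arcC arce _ (cpos _) (cpos _) => Aec.
  by rewrite (AA _ _ _ Aec Ac) eqxx in ee.
have n2 : \forall z \near c, forall x, z <> pos x.
  suff h x : \forall z \near c, z <> pos x by exact: filter_forall h.
  exact: near_neq.
have [r r0 disc] := near_disc (filterI n1 n2).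
have far x : r < dist2 (pos x) c by rewrite ltNge; apply/negP => /disc[_ /(_ x)].
have [A1' [x1 [_ [arc1' s1] A1x x1r o1]]] := stops_at_ex arc1 r0 (far u).
have [A2' [x2 [_ [arc2' s2] A2x x2r o2]]] := stops_at_ex (open_arc_sym arc2) r0 (far v).
have x12 : x1 <> x2 by move=> E; apply: (A12 _ A1x); rewrite E.
have [Q [Qr frame]] := frame_point x12 x1r x2r.
pose T := gmap x1 x2 Q; pose seg := gsegment x1 x2 Q.
have T6 i : (i < 6)%N -> dist2 (T i) c < r by move=> i6; exact: gmap_disc.
have seg_disc k z : (k < 13)%N -> seg k z -> dist2 z c < r by move=> k13; exact: gsegment_disc.
(* The two loose ends of [e0], attached to the gadget edges 11 and 12. *)
pose tail (k : nat) : set (R * R) := [set z |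
  (k = 11%N /\ (A1' z \/ z = x1)) \/ (k = 12%N /\ (A2' z \/ z = x2))].
have tailA k z : tail k z -> A e0 z.
  case=> -[_ [zA|->]].
  - exact/A1A/s1.
  - exact: A1A.
  - exact/A2A/s2.
  - exact: A2A.
have tail_far k z : tail k z -> r <= dist2 z c.
  by case=> -[_ [zA|->]]; rewrite ?x1r ?x2r //; apply/ltW; [exact: o1|exact: o2].
have tail_inj k l z : tail k z -> tail l z -> k = l.
  have t1 k' : tail k' z -> (k' = 11%N /\ A1 z) \/ (k' = 12%N /\ A2 z).
    case=> -[-> [zA|->]]; [left|left|right|right]; split=> //; [exact: s1|exact: s2].
  by move=> /t1[[-> z1]|[-> z2]] /t1[[-> z1']|[-> z2']] //; case: (A12 z).
pose npos (x : V + 'I_6) := match x with inl x => pos x | inr i => T i end.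
pose narc (e : edge replaced) : set (R * R) :=
  match e with inl e => A (val e) | inr k => tail k `|` seg k end.
exists npos, narc; split.
- case=> [x|i] [y|j] _ _ /=.
  + by move=> /pinj E; rewrite E ?inE.
  + by move=> E; exfalso; have := far x; have := T6 j (ltn_ord j); rewrite -E; lra.
  + by move=> E; exfalso; have := far y; have := T6 i (ltn_ord i); rewrite E; lra.
  + move=> E; congr inr; apply/val_inj; apply: gmap_inj E => //.
      by apply: ltn_trans (ltn_ord i) _.
    by apply: ltn_trans (ltn_ord j) _.
- case=> [[e /= ne]|k].
    have [x [y xy]] := ends_pair e; have [_ _ arce] := drawing_arc dr xy.
    by exists (inl x), (inl y); rewrite !inE xy imsetU1 imset_set1.
  exists (gvertex (gsrc k)), (gvertex (gtgt k)); rewrite !inE; split=> //=.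
  have k13 := ltn_ord k; have /and5P[t6 s8 st /eqP s6 /eqP s7] := gadget_edges_bounds k13.
  have sarc : open_arc (seg k) (T (gsrc k)) (T (gtgt k)) by exact: open_arc_gsegment.
  have -> : npos (gvertex (gtgt k)) = T (gtgt k) by rewrite gvertex_inr //= inordK.
  (* Treats the edges 11 and 12 together: a loose end continued by a gadget segment. *)
  have tail_ex A' p x : open_arc A' p x -> x = T (gsrc k) ->
      (forall z, A' z -> r < dist2 z c) -> r < dist2 p c ->
      (forall z, tail k z <-> A' z \/ z = x) ->
      dist2 x c = r -> open_arc (tail k `|` seg k) p (T (gtgt k)).
    move=> arc' xT far' pr tailE xr; rewrite -xT in sarc.
    have -> : tail k `|` seg k = [set z | [\/ A' z, z = x | seg k z]].
      apply/seteqP; split=> z /=.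
        by case=> [/tailE[]|]; [constructor 1|constructor 2|constructor 3].
      by case=> [zA|zx|]; [left; apply/tailE; left|left; apply/tailE; right|right].
    have Tr := T6 _ t6.
    apply: open_arc_concat arc' sarc _ _ _ _ _.
    + by move=> E; rewrite E xr ltxx in pr.
    + by move=> E; rewrite -E xr ltxx in Tr.
    + by move=> /(seg_disc _ _ k13); lra.
    + by move=> /far'; lra.
    + by move=> z /far' zr /(seg_disc _ _ k13); lra.
  have [k11|k11] := eqVneq (k : nat) 11%N.
    have s6' : gsrc k = 6%N by apply/eqP; rewrite s6 k11.
    rewrite {1}s6' /=; apply: (tail_ex A1' (pos u) x1) => //.
      by rewrite s6' /T gmap6.
    move=> z; split=> [[[_ //]|[k12]]|zx]; last by left.
    by rewrite k12 in k11.
  have [k12|k12] := eqVneq (k : nat) 12%N.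
    have s7' : gsrc k = 7%N by apply/eqP; rewrite s7 k12.
    rewrite {1}s7' /=; apply: (tail_ex A2' (pos v) x2) => //.
      by rewrite s7' /T gmap7.
    move=> z; split=> [[[k11' _]|[_ //]]|zx]; last by right.
    by rewrite k11' in k11.
  (* The other eleven edges join inner vertices, and their tails are empty. *)
  have s6' : (gsrc k < 6)%N.
    by move: s6 s7; rewrite (negbTE k11) (negbTE k12) => /negbT/eqP ? /negbT/eqP ?; lia.
  rewrite gvertex_inr //= inordK //.
  have -> : tail k `|` seg k = seg k; last by [].
  apply/seteqP; split=> z /=; last by right.
  by case=> // -[[kE _]|[kE _]]; [rewrite kE in k11|rewrite kE in k12].
- have disc_v z x : dist2 z c < r -> z <> pos x by move=> /ltW /disc[_ /(_ x)].
  case=> [[e /= ne]|k] [x|i] _ /=.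
  + by apply: Av; rewrite inE.
  + by have [/(_ e ne)] := disc _ (ltW (T6 i (ltn_ord i))).
  + case=> [/tailA|kx]; first by apply: Av; rewrite inE.
    by case: (disc_v _ x (seg_disc _ _ (ltn_ord k) kx)).
  + case=> [/tail_far|]; first by have := T6 i (ltn_ord i); lra.
    by apply: gsegment_avoids => //; apply: ltn_trans (ltn_ord i) _.
- have disj e k z : e != e0 -> A e z -> (tail k `|` seg k) z -> (k < 13)%N -> False.
    move=> ne Aez [/tailA /(AA _ _ _ Aez) E|kz] k13; first by rewrite E eqxx in ne.
    by have [/(_ e ne)] := disc _ (ltW (seg_disc _ _ k13 kz)).
  case=> [e|k] [e'|l] z /=.
  + by move=> /AA h /h /val_inj->.
  + by move=> h1 h2; case: (disj _ _ _ (valP e) h1 h2 (ltn_ord l)).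
  + by move=> h1 h2; case: (disj _ _ _ (valP e') h2 h1 (ltn_ord k)).
  + move=> zk zl; congr inr; apply/val_inj/eqP; apply/negPn/negP => kl.
    case: zk => [zk|zk]; case: zl => [zl|zl].
    * by case/eqP: kl; exact: tail_inj zk zl.
    * by have := tail_far _ _ zk; have := seg_disc _ _ (ltn_ord l) zl; lra.
    * by have := tail_far _ _ zl; have := seg_disc _ _ (ltn_ord k) zk; lra.
    * exact: (gsegment_disjoint frame (ltn_ord k) (ltn_ord l) kl zk zl).
Unshelve. all: by end_near.
Qed.

End ReplaceEdge.

(** Induction on the number of edges not marked [good]. Marked edges are neither loops nor parallel
    to each other and include the image of [H]. Replacing an unmarked edge marks all thirteen new
    ones; when no unmarked edge is left, the graph is simple. *)
Lemma simplify_edges (R : realType) (V0 : finType) (H : multigraph V0) n (V : finType)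
    (G : multigraph V) (good : pred (edge G)) (f : V0 -> V) (g : edge H -> edge G) :
  (\sum_e (~~ good e) = n)%N -> regular 4 G -> planar R G ->
  (forall e, good e -> #|ends G e| = 2%N) -> {in good &, injective (ends G)} ->
  injective f -> injective g ->
  (forall e, good (g e) /\ ends G (g e) = [set f x | x in ends H e]%SET) ->
  exists (W : finType) (G' : multigraph W),
    [/\ simple G', regular 4 G', planar R G' & subgraph H G'].
Proof.
elim: n V G good f g => [|n IH] V G good f g bad reg pl card2 inj finj ginj gE.
  have allgood e : good e.
    move/eqP: bad; rewrite sum_nat_eq0 => /forallP/(_ e)/implyP/(_ isT).
    by case: (good e).
  exists V, G; split=> //; first by split=> [e|e e']; [exact: card2|apply: inj; exact: allgood].
  by exists f; split=> //; exists g => // e; case: (gE e).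
have [e0 bad0] : exists e, ~~ good e.
  apply/existsP; rewrite -negb_forall; apply/negP => /forallP allgood.
  by move: bad; rewrite big1 // => e _; rewrite allgood.
have [u [v uv]] := ends_pair e0.
pose good' (e : edge (replaced e0 u v)) := match e with inl e => good (val e) | inr _ => true end.
have away e : g e \in [pred e : edge G | e != e0].
  by rewrite inE; apply: contraNneq bad0 => <-; case: (gE e).
apply: (IH _ (replaced e0 u v) good' (inl \o f) (fun e => inl (exist _ (g e) (away e)))).
- rewrite big_sumType /= -(big_sub _ (fun e => ~~ good e : nat)) big1_eq addn0.
  by move: bad; rewrite (bigD1 e0) //= bad0 add1n => -[].
- exact: degree_replaced.
- exact: planar_replaced.
- case=> [e ge|k _]; last exact: (replaced_inr_card e0 u v k).
  by rewrite /= card_inl_ends; exact: card2.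
- case=> [e|k] [e'|l] ge ge' /= E.
  + by congr inl; apply/val_inj/inj => //; exact: imset_inj (@inl_inj _ _) _ _ E.
  + by case: (replaced_inl_inr E).
  + by case: (replaced_inl_inr (esym E)).
  + by congr inr; exact: (@replaced_inr_inj _ _ e0 u v k l E).
- by move=> x y [/finj].
- by move=> e e' [/ginj].
- by move=> e; have [ge E] := gE e; split=> //=; rewrite E -imset_comp.
Qed.

Theorem theorem17p4 (R : realType) (V : finType) (H : multigraph V)
    (H_simple : simple H) (H_planar : planar R H)
    (H_deg : (max_degree H <= 4)%N) :
  (exists (W : finType) (G : multigraph W),
     [/\ simple G, regular 4 G, planar R G & subgraph H G])
  <->
  (exists G' : multigraph V,
     [/\ regular 4 G', planar R G' & spanning_subgraph H G']).
Proof.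
split=> [[W [G [_ reg pl sub]]]|[G [reg pl [idinj [g ginj gE]]]]].
  exact: spanning_of_simple reg pl sub.
have [card2 Hinj] := H_simple.
have gH e : ends G (g e) = ends H e by rewrite gE imset_id.
(* Initially exactly the edges of [H] are marked. *)
apply: (@simplify_edges R V H _ V G (mem (codom g)) id g (erefl _)) => //.
- by move=> e /codomP[e' ->]; rewrite gH.
- by move=> _ _ /codomP[e ->] /codomP[e' ->]; rewrite !gH => /Hinj->.
- by move=> e; split; [exact: codom_f|exact: gE].
Qed.
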